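(* Let $A\subseteq\omega$ be $0'$-c.e. (computably enumerable relative to $0'$) with $A$ strictly Turing-above $0'$ (i.e. $0'\leq_{\mathrm{T}}A$ and $A\not\leq_{\mathrm{T}}0'$). Then there are $A$-computable existentially closed groups $M$ and $N$ which are relatively atomic.
   Context: The language of groups is $L=\{1,\cdot,{}^{-1}\}$ and $T$ is the theory of groups. A group $M$ is existentially closed if for every quantifier-free $L$-formula $\varphi(\overline{x},\overline{m})$ with parameters from $M$, if some group $N\geq M$ satisfies $\exists\overline{x}\,\varphi(\overline{x},\overline{m})$, then so does $M$. All existentially closed groups are assumed countable. A group $M$ is $A$-computable if for some enumeration of $M$, its quantifier-free diagram $\Delta^{\mathrm{qf}}(M)$ (the set of quantifier-free sentences of $L$, with constants for the enumerated elements, true in $M$) is Turing-computable from $A$. A complete quantifier-free type $\Phi(\overline{x})$ (in finitely many variables, without parameters) is $\exists_1$-isolated if there is an existential $L$-formula $\varphi(\overline{x})$ such that $\Phi$ is the unique complete quantifier-free type consistent with $\varphi$ over $T$. Two groups $M,N$ are relatively atomic if every complete quantifier-free type realised in both of them is $\exists_1$-isolated. *)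

(* Defs.v *)
From mathcomp Require Import all_boot.
From mathcomp Require Import classical_sets.

Set Implicit Arguments.
Unset Strict Implicit.
Unset Printing Implicit Defensive.

Local Open Scope classical_set_scope.

(* The Cantor pairing function, a bijection from nat * nat to nat. *)
Definition cpair (a b : nat) : nat := 'C((a + b).+1, 2) + b.

(* Programs for the unary partial recursive functions with an oracle; functions
   of several arguments are handled through [cpair]. *)
Inductive program : Type :=
| Zero
| Succ
| Fst
| Snd
| Oracle
| Pair of program & program
| Comp of program & program
| Rec of program & program
| Mu of program.

(* [eval X p n r]: program [p] with oracle (the characteristic function of) [X]
   halts on input [n] with output [r]. *)
Inductive eval (X : set nat) : program -> nat -> nat -> Prop :=
| eval_zero n : eval X Zero n 0
| eval_succ n : eval X Succ n n.+1
| eval_fst a b : eval X Fst (cpair a b) a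
| eval_snd a b : eval X Snd (cpair a b) b
| eval_oracle_in n : X n -> eval X Oracle n 1
| eval_oracle_out n : ~ X n -> eval X Oracle n 0
| eval_pair p q n a b :
    eval X p n a -> eval X q n b -> eval X (Pair p q) n (cpair a b)
| eval_comp p q n a b :
    eval X q n a -> eval X p a b -> eval X (Comp p q) n b
| eval_rec0 p q a r :
    eval X p a r -> eval X (Rec p q) (cpair a 0) r
| eval_recS p q a n r s :
    eval X (Rec p q) (cpair a n) r -> eval X q (cpair a (cpair n r)) s ->
    eval X (Rec p q) (cpair a n.+1) s
(* [r] gives the (nonzero) predecessors of the values of [p] below [n]: the
   search is only allowed to pass arguments at which [p] halts. *)
| eval_mu p a n (r : nat -> nat) :
    (forall m, m < n -> eval X p (cpair a m) (r m).+1) ->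
    eval X p (cpair a n) 0 -> eval X (Mu p) a n.

Fixpoint program_code (p : program) : nat :=
  match p with
  | Zero => cpair 0 0
  | Succ => cpair 1 0
  | Fst => cpair 2 0
  | Snd => cpair 3 0
  | Oracle => cpair 4 0
  | Pair p q => cpair 5 (cpair (program_code p) (program_code q))
  | Comp p q => cpair 6 (cpair (program_code p) (program_code q))
  | Rec p q => cpair 7 (cpair (program_code p) (program_code q))
  | Mu p => cpair 8 (program_code p)
  end.

Definition turing_le (Y X : set nat) : Prop :=
  exists p, forall n,
    (Y n -> eval X p n 1) /\ (~ Y n -> eval X p n 0).

(* [Y] is computably enumerable relative to [X]: it is the domain of a function
   partial computable in [X]. *)
Definition ce_in (X Y : set nat) : Prop :=
  exists p, forall n, Y n <-> exists r, eval X p n r.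

(* The diagonal halting problem; a number that is not the code of a program is
   an index of the empty function. *)
Definition jump (X : set nat) : set nat :=
  [set e | exists p r, program_code p = e /\ eval X p e r].

Definition zero_jump : set nat := jump set0.

(* [V] is the type of atoms, standing for variables or for new constants. *)
Inductive term (V : Type) : Type :=
| TVar of V
| TOne
| TMul of term V & term V
| TInv of term V.

Arguments TOne {V}.

Inductive qf_formula (V : Type) : Type :=
| QEq of term V & term V
| QNot of qf_formula V
| QAnd of qf_formula V & qf_formula V
| QOr of qf_formula V & qf_formula V.

(* The existential formula "exists y_0 ... y_(k-1), matrix" in the free
   variables x_0, ..., x_(n-1): [inl i] is x_i and [inr j] is y_j. *)
Record ex_formula (n : nat) : Type := ExFormula {
  ex_arity : nat;
  ex_matrix : qf_formula ('I_n + 'I_ex_arity)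
}.

Section Semantics.

Variables (G : groupType).

Fixpoint eval_term (V : Type) (v : V -> G) (t : term V) : G :=
  match t with
  | TVar x => v x
  | TOne => 1%g
  | TMul s t => (eval_term v s * eval_term v t)%g
  | TInv t => (eval_term v t)^-1%g
  end.

Fixpoint qf_sat (V : Type) (v : V -> G) (phi : qf_formula V) : Prop :=
  match phi with
  | QEq s t => eval_term v s = eval_term v t
  | QNot phi => ~ qf_sat v phi
  | QAnd phi psi => qf_sat v phi /\ qf_sat v psi
  | QOr phi psi => qf_sat v phi \/ qf_sat v psi
  end.

Definition ex_sat (n : nat) (v : 'I_n -> G) (phi : ex_formula n) : Prop :=
  exists w : 'I_(ex_arity phi) -> G,
    qf_sat (fun a => match a with inl i => v i | inr j => w j end)
           (ex_matrix phi).

End Semantics.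

(* The free variables of [phi] are those to be replaced by the parameters [m];
   the extensions [N] of [M] are given up to isomorphism over [M]. *)
Definition existentially_closed (M : groupType) : Prop :=
  forall (k : nat) (phi : ex_formula k) (m : 'I_k -> M)
         (N : groupType) (f : {multiplicative M -> N}),
    injective f -> ex_sat (f \o m) phi -> ex_sat m phi.

Fixpoint term_code (t : term nat) : nat :=
  match t with
  | TVar i => cpair 0 i
  | TOne => cpair 1 0
  | TMul s t => cpair 2 (cpair (term_code s) (term_code t))
  | TInv t => cpair 3 (term_code t)
  end.

Fixpoint qf_code (phi : qf_formula nat) : nat :=
  match phi with
  | QEq s t => cpair 0 (cpair (term_code s) (term_code t))
  | QNot phi => cpair 1 (qf_code phi)
  | QAnd phi psi => cpair 2 (cpair (qf_code phi) (qf_code psi))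
  | QOr phi psi => cpair 3 (cpair (qf_code phi) (qf_code psi))
  end.

(* The set of codes of quantifier-free sentences true in [M], the constant
   number [i] being interpreted by [e i]. *)
Definition qf_diagram (M : groupType) (e : nat -> M) : set nat :=
  [set c | exists phi, qf_code phi = c /\ qf_sat e phi].

(* An enumeration is a surjection from nat, possibly with repetitions; in
   particular such a group is countable. *)
Definition computable_group (A : set nat) (M : groupType) : Prop :=
  exists e : nat -> M,
    (forall x, exists i, e i = x) /\ turing_le (qf_diagram e) A.

Definition satisfies_type (G : groupType) (n : nat) (v : 'I_n -> G)
    (Phi : set (qf_formula 'I_n)) : Prop :=
  forall phi, Phi phi -> qf_sat v phi.

Definition realised_in (G : groupType) (n : nat)
    (Phi : set (qf_formula 'I_n)) : Prop :=
  exists v : 'I_n -> G, satisfies_type v Phi.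

(* Consistency over the theory of groups is taken as satisfiability in some
   group. *)
Definition complete_qf_type (n : nat) (Phi : set (qf_formula 'I_n)) : Prop :=
  (exists G : groupType, realised_in G Phi) /\
  (forall phi, Phi phi \/ Phi (QNot phi)).

Definition consistent_with (n : nat) (Phi : set (qf_formula 'I_n))
    (psi : ex_formula n) : Prop :=
  exists (G : groupType) (v : 'I_n -> G), satisfies_type v Phi /\ ex_sat v psi.

Definition ex_isolated (n : nat) (Phi : set (qf_formula 'I_n)) : Prop :=
  exists psi : ex_formula n,
    consistent_with Phi psi /\
    forall Psi : set (qf_formula 'I_n),
      complete_qf_type Psi -> consistent_with Psi psi -> Psi = Phi.

Definition relatively_atomic (M N : groupType) : Prop :=
  forall (n : nat) (Phi : set (qf_formula 'I_n)),
    complete_qf_type Phi -> realised_in M Phi -> realised_in N Phi ->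
    ex_isolated Phi.

(* Main.v *)
Require Import Defs.
From HB Require Import structures.
From mathcomp Require Import all_boot.
From mathcomp Require Import boolp classical_sets.

(* The consistency of a finite condition with the theory of groups is decidable
   from [0'], so generic existentially closed groups can be built recursively in
   [0'].  Let [M] be one of them.  As [A] is c.e. but not computable in [0'], the
   modulus [g] of its enumeration is computable in [A] and not dominated by any
   function computable in [0'].  The group [N] is built
   generically as well, but at stage [t] one also looks, below [g t], for a
   formula making some tuple of [N] differ from some tuple of [M].  If a
   non-isolated type were realised in both groups, the search for the
   corresponding pair of tuples would succeed from every condition but fail
   within the bounds [g t]; then the possible conditions at each late stage form
   a finite set computable in [0'], and the largest search needed from one of
   them dominates [g]. *)

Set Implicit Arguments.
Unset Strict Implicit.
Unset Printing Implicit Defensive.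

(** * Pairing *)

(** A condition is a number coding a propositional formula whose atoms are equations between names,
    and the group axioms become a computable list of such formulas. Inconsistency shows up against
    finitely many axioms, so it is c.e.; this is why 0' decides consistency. The obstacle is that
    [N] is built with the help of [g], so its actual sequence of conditions need not be computable
    from 0', while the dominating function must be. The way out is that upper bounds suffice: a
    bound on the condition at a stage bounds the search needed from it, this bounds [g] there, and
    this in turn bounds the next condition. Both bounds come from one induction, started at the
    actual condition of a late stage. Lateness matters because the requirements of higher priority
    must have stopped acting. Each of them acts finitely often, since what it forces stays forced
    and the search bounds never shrink. The diagram of [M] has to be computable from 0', because the
    searches consult it. *)

Definition unpair (n : nat) : nat * nat :=
  iter n (fun ab => if ab.1 is a.+1 then (a, ab.2.+1) else (ab.2.+1, 0)) (0, 0).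
Definition cfst n := (unpair n).1.
Definition csnd n := (unpair n).2.

Lemma cpairE a b : cpair a b = 'C(a + b, 2) + (a + b) + b.
Proof. by rewrite /cpair binS bin1. Qed.

Lemma cpair_Sr a b : cpair a b.+1 = (cpair a.+1 b).+1.
Proof. by rewrite /cpair addnS addSn addnS. Qed.

Lemma cpair_S0 a : cpair a.+1 0 = (cpair 0 a).+1.
Proof. by rewrite /cpair addn0 add0n binS bin1 addn0 addnS. Qed.

Lemma unpairK n : cpair (cfst n) (csnd n) = n.
Proof.
elim: n => [//|n]; rewrite /cfst /csnd /unpair iterS.
case: (iter n _ _) => [[|a] b] /= <-; first by rewrite cpair_S0.
by rewrite cpair_Sr.
Qed.

Lemma unpair_cpair a b : unpair (cpair a b) = (a, b).
Proof.
move: {2}(cpair a b) (erefl (cpair a b)) => n; elim: n a b => [|n IHn] a b.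
  rewrite cpairE => /eqP; rewrite !addn_eq0 => /andP[/andP[_ /andP[/eqP-> _]]].
  by move/eqP->.
case: b => [|b]; last first.
  rewrite cpair_Sr => -[] /IHn.
  by rewrite /unpair iterS => ->.
case: a => [//|a]; rewrite cpair_S0 => -[] /IHn.
by rewrite /unpair iterS => ->.
Qed.

Lemma cfst_cpair a b : cfst (cpair a b) = a.
Proof. by rewrite /cfst unpair_cpair. Qed.

Lemma csnd_cpair a b : csnd (cpair a b) = b.
Proof. by rewrite /csnd unpair_cpair. Qed.

Definition unpairE := (cfst_cpair, csnd_cpair, unpairK).

Lemma cpair_inj a b c d : cpair a b = cpair c d -> a = c /\ b = d.
Proof. by move/(congr1 unpair); rewrite !unpair_cpair => -[]. Qed.

Lemma leq_cpairl a b : a <= cpair a b.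
Proof. by rewrite cpairE -addnA -addnA addnCA leq_addr. Qed.

Lemma leq_cpairr a b : b <= cpair a b.
Proof. by rewrite cpairE leq_addl. Qed.

Lemma ltn_cpairr a b : 0 < a -> b < cpair a b.
Proof. by case: a => // a _; rewrite cpairE -[X in X < _]add0n ltn_add2r addSn addnS. Qed.

Lemma leq_cfst n : cfst n <= n.
Proof. by rewrite -{2}(unpairK n) leq_cpairl. Qed.

Lemma leq_csnd n : csnd n <= n.
Proof. by rewrite -{2}(unpairK n) leq_cpairr. Qed.

Lemma ltn_csnd n : 0 < n -> csnd n < n.
Proof.
move=> n_gt0; rewrite -{2}(unpairK n).
have [e|/ltn_cpairr//] := posnP (cfst n).
move: n_gt0; rewrite -{1}(unpairK n) e !cpairE !add0n; case: (csnd n) => // m _.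
by rewrite -[X in X < _]add0n ltn_add2r addnS.
Qed.

Opaque cpair cfst csnd.

(** * Closure properties of the computable functions *)

Definition computable (X : set nat) (f : nat -> nat) : Prop :=
  exists p, forall n, eval X p n (f n).

Lemma turing_leP (Y X : set nat) :
  turing_le Y X <-> computable X (fun n => `[< Y n >]).
Proof.
split=> -[p pP]; exists p => n; last first.
  by split=> Yn; have := pP n; [rewrite asboolT | rewrite asboolF].
by case: asboolP => Yn; [apply: (pP n).1 | apply: (pP n).2].
Qed.

Section Computable.

Variable X : set nat.
Implicit Types (f g h N : nat -> nat) (P Q : nat -> bool).

Local Notation comp := (computable X).

Definition computable2 (F : nat -> nat -> nat) :=
  comp (fun z => F (cfst z) (csnd z)).

Definition computable3 (F : nat -> nat -> nat -> nat) :=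
  comp (fun z => F (cfst z) (cfst (csnd z)) (csnd (csnd z))).

Lemma eq_computable f g : g =1 f -> comp f -> comp g.
Proof. by move=> /funext ->. Qed.

Lemma computable_cpair f g : comp f -> comp g -> comp (fun z => cpair (f z) (g z)).
Proof. by move=> [p pP] [q qP]; exists (Pair p q) => n; apply: eval_pair. Qed.

Lemma computable_fst : comp cfst.
Proof. by exists Fst => n; rewrite -{1}(unpairK n); apply: eval_fst. Qed.

Lemma computable_snd : comp csnd.
Proof. by exists Snd => n; rewrite -{1}(unpairK n); apply: eval_snd. Qed.

Lemma computable_id : comp (fun z => z).
Proof.
apply: (@eq_computable (fun z => cpair (cfst z) (csnd z))).
  by move=> z; rewrite unpairK.
by apply: computable_cpair computable_fst computable_snd.
Qed.

Lemma computable_comp f g : comp f -> comp g -> comp (fun z => f (g z)).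
Proof. by move=> [p pP] [q qP]; exists (Comp p q) => n; apply: eval_comp. Qed.

Lemma computable_cfst f : comp f -> comp (fun z => cfst (f z)).
Proof. exact: computable_comp computable_fst. Qed.

Lemma computable_csnd f : comp f -> comp (fun z => csnd (f z)).
Proof. exact: computable_comp computable_snd. Qed.

Lemma computable_succ f : comp f -> comp (fun z => (f z).+1).
Proof. by apply: computable_comp; exists Succ => n; apply: eval_succ. Qed.

Lemma computable_const c : comp (fun _ => c).
Proof.
elim: c => [|c IHc]; last exact: computable_succ.
by exists Zero => n; apply: eval_zero.
Qed.

Lemma computable_comp2 F f g : computable2 F -> comp f -> comp g ->
  comp (fun z => F (f z) (g z)).
Proof.
move=> Fc fc gc; have := computable_comp Fc (computable_cpair fc gc).
by apply: eq_computable => z; rewrite !unpairE.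
Qed.

Lemma computable_comp3 F f g h : computable3 F -> comp f -> comp g -> comp h ->
  comp (fun z => F (f z) (g z) (h z)).
Proof.
move=> Fc fc gc hc.
have := computable_comp Fc (computable_cpair fc (computable_cpair gc hc)).
by apply: eq_computable => z; rewrite !unpairE.
Qed.

Lemma computable_oracle f : comp f -> comp (fun z => `[< X (f z) >]).
Proof.
apply: (@computable_comp (fun n => `[< X n >])); exists Oracle => n.
by case: asboolP => Xn; [apply: eval_oracle_in | apply: eval_oracle_out].
Qed.

Lemma computable_rec f (F : nat -> nat -> nat -> nat) N :
  comp f -> computable3 F -> comp N ->
  comp (fun z => nat_rect (fun=> nat) (f z) (F z) (N z)).
Proof.
move=> [p pP] [q qP] Nc.
pose G z := nat_rect (fun=> nat) (f z) (F z).
apply: (@computable_comp2 G id N _ computable_id Nc).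
exists (Rec p q) => z; rewrite -{1}(unpairK z).
elim: (csnd z) => [|n IHn] /=; first exact: eval_rec0.
apply: eval_recS; first exact: IHn.
by have := qP (cpair (cfst z) (cpair n (G (cfst z) n))); rewrite !unpairE.
Qed.

Lemma computable_mu (P : nat -> nat -> bool) f :
  computable2 (fun z n => ~~ P z n) ->
  (forall z, P z (f z)) -> (forall z m, m < f z -> ~~ P z m) ->
  comp f.
Proof.
move=> [p pP] Pf minf; exists (Mu p) => z.
(* Below the minimum [~~ P] has the value 1, whose predecessor is 0. *)
apply: (@eval_mu _ _ _ _ (fun=> 0)) => [m /minf Pm|].
  by have := pP (cpair z m); rewrite !unpairE Pm.
by have := pP (cpair z (f z)); rewrite !unpairE Pf.
Qed.

End Computable.

Create HintDb comp discriminated.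
Hint Resolve computable_const computable_id computable_cfst computable_csnd : comp.
Hint Resolve computable_cpair computable_succ : comp.
#[global] Hint Unfold computable2 computable3 : comp.

Ltac comp := rewrite ?/computable2 ?/computable3; auto 200 with comp nocore.

Section Arithmetic.

Variable X : set nat.
Implicit Types (f g h N : nat -> nat) (P Q : nat -> bool).

Local Notation comp := (computable X).

Lemma computable_add f g : comp f -> comp g -> comp (fun z => f z + g z).
Proof.
move=> fc gc.
apply: (@eq_computable _ (fun z => nat_rect (fun=> nat) (f z) (fun _ r => r.+1) (g z))).
  by move=> z; elim: (g z) => [|n IHn] /=; rewrite ?addn0 ?addnS ?IHn.
by apply: computable_rec => //; comp.
Qed.

Lemma computable_pred f : comp f -> comp (fun z => (f z).-1).
Proof.
move=> fc.
apply: (@eq_computable _ (fun z => nat_rect (fun=> nat) 0 (fun k _ => k) (f z))).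
  by move=> z; case: (f z).
by apply: computable_rec => //; comp.
Qed.

Lemma computable_sub f g : comp f -> comp g -> comp (fun z => f z - g z).
Proof.
move=> fc gc.
apply: (@eq_computable _ (fun z => nat_rect (fun=> nat) (f z) (fun _ r => r.-1) (g z))).
  by move=> z; elim: (g z) => [|n IHn] /=; rewrite ?subn0 ?subnS ?IHn.
apply: computable_rec => //.
by rewrite /computable3; apply: computable_pred; comp.
Qed.

Lemma computable_mul f g : comp f -> comp g -> comp (fun z => f z * g z).
Proof.
move=> fc gc.
apply: (@eq_computable _ (fun z => nat_rect (fun=> nat) 0 (fun _ r => r + f z) (g z))).
  by move=> z; elim: (g z) => [|n IHn] /=; rewrite ?muln0 ?mulnSr ?IHn.
apply: (@computable_rec _ _ (fun z _ r => r + f z)) => //; first by comp.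
apply: computable_add; first by comp.
by apply: computable_comp fc _; comp.
Qed.

Lemma computable_expn c f : comp f -> comp (fun z => c ^ f z).
Proof.
move=> fc.
apply: (@eq_computable _ (fun z => nat_rect (fun=> nat) 1 (fun _ r => c * r) (f z))).
  by move=> z; elim: (f z) => [|n IHn] //=; rewrite expnS IHn.
by apply: computable_rec => //; [comp|apply: computable_mul; comp].
Qed.

Lemma computable_if P f g : comp (fun z => P z) -> comp f -> comp g ->
  comp (fun z => if P z then f z else g z).
Proof.
move=> Pc fc gc.
apply: (@eq_computable _ (fun z => nat_rect (fun=> nat) (g z) (fun _ _ => f z) (P z))).
  by move=> z; case: (P z).
apply: (@computable_rec _ _ (fun z _ _ => f z)) => //.
by apply: computable_comp fc _; comp.
Qed.

Lemma computable_if_bool P Q1 Q2 :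
  comp (fun z => P z) -> comp (fun z => Q1 z) -> comp (fun z => Q2 z) ->
  comp (fun z => (if P z then Q1 z else Q2 z)).
Proof.
move=> Pc Q1c Q2c; have := computable_if Pc Q1c Q2c.
by apply: eq_computable => z; case: (P z).
Qed.

Lemma computable_negb P : comp (fun z => P z) -> comp (fun z => ~~ P z).
Proof.
move=> Pc; apply: (@eq_computable _ (fun z => 1 - P z)); first by move=> z; case: (P z).
by apply: computable_sub => //; comp.
Qed.

Lemma computable_andb P Q : comp (fun z => P z) -> comp (fun z => Q z) ->
  comp (fun z => P z && Q z).
Proof.
move=> Pc Qc; apply: (@eq_computable _ (fun z => P z * Q z)).
  by move=> z; case: (P z); case: (Q z).
exact: computable_mul.
Qed.

Lemma computable_orb P Q : comp (fun z => P z) -> comp (fun z => Q z) ->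
  comp (fun z => P z || Q z).
Proof.
move=> /computable_negb Pc /computable_negb Qc.
have := computable_negb (computable_andb Pc Qc).
by apply: eq_computable => z; case: (P z); case: (Q z).
Qed.

Lemma computable_eq0 f : comp f -> comp (fun z => f z == 0).
Proof.
move=> fc; apply: (@eq_computable _ (fun z => 1 - f z)); first by move=> z; case: (f z).
by apply: computable_sub => //; comp.
Qed.

Lemma computable_leq f g : comp f -> comp g -> comp (fun z => f z <= g z).
Proof. by move=> fc gc; apply/computable_eq0/computable_sub. Qed.

Lemma computable_eqn f g : comp f -> comp g -> comp (fun z => f z == g z).
Proof.
move=> fc gc; apply: (@eq_computable _ (fun z => (f z <= g z) && (g z <= f z))).
  by move=> z; rewrite eqn_leq.
by apply: computable_andb; apply: computable_leq.
Qed.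

Lemma computable_odd f : comp f -> comp (fun z => odd (f z)).
Proof.
move=> fc.
apply: (@eq_computable _ (fun z => nat_rect (fun=> nat) 0 (fun _ r => 1 - r) (f z))).
  by move=> z; elim: (f z) => //= n <-; case: (odd n).
by apply: computable_rec => //; [comp|apply: computable_sub; comp].
Qed.

Lemma computable_half f : comp f -> comp (fun z => (f z)./2).
Proof.
move=> fc.
apply: (@eq_computable _ (fun z => nat_rect (fun=> nat) 0 (fun k r => odd k + r) (f z))).
  by move=> z; elim: (f z) => //= n <-; rewrite uphalf_half.
apply: computable_rec => //; first by comp.
by apply: computable_add; [apply: computable_odd|]; comp.
Qed.

Lemma computable_iter (F : nat -> nat -> nat) f N :
  computable2 X F -> comp f -> comp N ->
  comp (fun z => iter (N z) (F z) (f z)).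
Proof.
move=> Fc fc Nc.
apply: (@eq_computable _ (fun z => nat_rect (fun=> nat) (f z) (fun _ r => F z r) (N z))).
  by move=> z; elim: (N z) => //= n ->.
apply: (@computable_rec _ _ (fun z _ r => F z r)) => //.
by apply: computable_comp2; [exact: Fc|comp|comp].
Qed.

Lemma computable_has (P : nat -> nat -> bool) N :
  computable2 X (fun z k => P z k) -> comp N ->
  comp (fun z => has (P z) (iota 0 (N z))).
Proof.
move=> Pc Nc.
apply: (@eq_computable _ (fun z => nat_rect (fun=> nat) 0
  (fun k r => ~~ (r == 0) || P z k) (N z))).
  move=> z; elim: (N z) => // n IHn.
  rewrite -addn1 iotaD has_cat /= orbF add0n addn1 /= -IHn eqb0 negbK.
  by case: (has _ _).
apply: (@computable_rec _ _ (fun z k r => ~~ (r == 0) || P z k)) => //; first by comp.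
apply: computable_orb; first by apply/computable_negb/computable_eq0; comp.
by apply: (computable_comp2 Pc); comp.
Qed.

Lemma computable_all (P : nat -> nat -> bool) N :
  computable2 X (fun z k => P z k) -> comp N ->
  comp (fun z => all (P z) (iota 0 (N z))).
Proof.
move=> Pc Nc.
have := computable_negb (computable_has (P := fun z k => ~~ P z k)
  (computable_negb Pc) Nc).
by apply: eq_computable => z; rewrite has_predC negbK.
Qed.

Lemma computable_find (P : nat -> nat -> bool) N :
  computable2 X (fun z k => P z k) -> comp N ->
  comp (fun z => find (P z) (iota 0 (N z))).
Proof.
move=> Pc Nc.
(* Invariant: the accumulator [r] is below [k] exactly when some index below [k] satisfies the
   predicate, and equals [k] otherwise. *)
apply: (@eq_computable _ (fun z => nat_rect (fun=> nat) 0
  (fun k r => if r < k then r else if P z k then k else k.+1) (N z))).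
  move=> z; elim: (N z) => // n IHn.
  rewrite -addn1 iotaD find_cat /= add0n addn1 /= -IHn size_iota.
  have -> : (find (P z) (iota 0 n) < n) = has (P z) (iota 0 n).
    by rewrite has_find size_iota.
  by case: (has _ _); case: (P z n); rewrite // ?addn0 ?addn1.
apply: (@computable_rec _ _
  (fun z k r => if r < k then r else if P z k then k else k.+1)) => //.
  by comp.
apply: computable_if; first (by apply: computable_leq; comp); first by comp.
by apply: computable_if; [apply: (computable_comp2 Pc)| |]; comp.
Qed.

Lemma computable_bigmax (F : nat -> nat -> nat) N :
  computable2 X F -> comp N ->
  comp (fun z => \max_(i < N z) F z i).
Proof.
move=> Fc Nc.
apply: (@eq_computable _ (fun z => nat_rect (fun=> nat) 0
  (fun k r => if r < F z k then F z k else r) (N z))).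
  by move=> z; elim: (N z) => [|n IHn]; rewrite ?big_ord0 // big_ord_recr /= IHn.
apply: (@computable_rec _ _ (fun z k r => if r < F z k then F z k else r)) => //.
  by comp.
have Fc' : comp (fun z => F (cfst z) (cfst (csnd z))).
  by apply: (computable_comp2 Fc); comp.
by apply: computable_if => //; [apply: computable_leq|]; comp.
Qed.

End Arithmetic.

Hint Resolve computable_if_bool computable_negb computable_andb computable_orb : comp.
Hint Resolve computable_leq computable_eqn computable_odd computable_half : comp.
Hint Resolve computable_add computable_pred computable_sub computable_mul : comp.
Hint Resolve computable_expn computable_if : comp.

(** * Recursion on codes *)

Section Trec.

Variables (T : Type) (F : nat -> T -> T -> T -> T) (d : T).

Fixpoint trec_fuel k n : T :=
  if k is k'.+1 then
    if n == 0 then F 0 d d d else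
    F n (trec_fuel k' (csnd n)) (trec_fuel k' (cfst (csnd n)))
        (trec_fuel k' (csnd (csnd n)))
  else d.

(* The arguments of [F] are the values at the payload of [n] and at the two
   components of that payload; [0] is the only number that does not exceed its
   payload. *)
Definition trec n := trec_fuel n.+1 n.

Lemma trec_fuelE k n : n < k -> trec_fuel k n = trec n.
Proof.
rewrite /trec; have [m] := ubnP n; elim: m n k => // m IHm n [//|k] /ltnSE lenm.
rewrite ltnS => lenk /=; case: eqP => // /eqP; rewrite -lt0n => n_gt0.
have lt0 := ltn_csnd n_gt0.
have lt1 : cfst (csnd n) < n by apply: leq_ltn_trans (leq_cfst _) lt0.
have lt2 : csnd (csnd n) < n by apply: leq_ltn_trans (leq_csnd _) lt0.
rewrite !(IHm _ k) ?(leq_trans _ lenk) ?(leq_trans _ lenm) //.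
by rewrite !(IHm _ n) ?(leq_trans _ lenm).
Qed.

Lemma trecE n : 0 < n ->
  trec n = F n (trec (csnd n)) (trec (cfst (csnd n))) (trec (csnd (csnd n))).
Proof.
move=> n_gt0; rewrite {1}/trec /= eqn0Ngt n_gt0 /=.
have lt0 := ltn_csnd n_gt0.
by rewrite !trec_fuelE // (leq_ltn_trans _ lt0) ?leq_cfst ?leq_csnd.
Qed.

Lemma trec0 : trec 0 = F 0 d d d.
Proof. by []. Qed.

End Trec.

Lemma code_ind (P : nat -> Prop) : P 0 ->
  (forall n, 0 < n -> P (csnd n) -> P (cfst (csnd n)) -> P (csnd (csnd n)) -> P n) ->
  forall n, P n.
Proof.
move=> P0 PS n; have [m] := ubnP n; elim: m n => // m IHm n /ltnSE lenm.
have [->//|n_gt0] := posnP n; have lt0 := leq_trans (ltn_csnd n_gt0) lenm.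
apply: PS => //; apply: IHm => //.
  exact: leq_ltn_trans (leq_cfst _) lt0.
exact: leq_ltn_trans (leq_csnd _) lt0.
Qed.

(** Transports a recursion along a map of value types: from booleans to numbers for computability,
    from syntax to group elements and truth values for semantics. *)
Lemma trec_morph (T U : Type) (phi : T -> U) F F' d d' :
  phi d = d' -> (forall n a b c, phi (F n a b c) = F' n (phi a) (phi b) (phi c)) ->
  forall n, phi (trec F d n) = trec F' d' n.
Proof.
move=> phid phiF; elim/code_ind => [|n n_gt0 IH0 IH1 IH2].
  by rewrite !trec0 phiF phid.
by rewrite (trecE F d n_gt0) (trecE F' d' n_gt0) phiF IH0 IH1 IH2.
Qed.

Section ComputableTrec.

Variable X : set nat.

Local Notation comp := (computable X).

Definition computable5 (F : nat -> nat -> nat -> nat -> nat -> nat) :=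
  comp (fun z => F (cfst z) (cfst (csnd z)) (cfst (csnd (csnd z)))
    (cfst (csnd (csnd (csnd z)))) (csnd (csnd (csnd (csnd z))))).

Lemma computable_comp5 F f0 f1 f2 f3 f4 : computable5 F ->
  comp f0 -> comp f1 -> comp f2 -> comp f3 -> comp f4 ->
  comp (fun z => F (f0 z) (f1 z) (f2 z) (f3 z) (f4 z)).
Proof.
move=> Fc c0 c1 c2 c3 c4.
have := computable_comp Fc (computable_cpair c0 (computable_cpair c1
  (computable_cpair c2 (computable_cpair c3 c4)))).
by apply: eq_computable => z; rewrite !unpairE.
Qed.

(** Course-of-values recursion is reduced to primitive recursion by carrying the table of all
    earlier values along as one number. *)
Lemma computable_trec (F : nat -> nat -> nat -> nat -> nat -> nat) d N :
  computable5 F -> comp N -> comp (fun z => trec (F z) d (N z)).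
Proof.
move=> Fc Nc; pose look n i t := cfst (iter (n - i).-1 csnd t).
pose S z n t := if n == 0 then F z 0 d d d else
  F z n (look n (csnd n) t) (look n (cfst (csnd n)) t) (look n (csnd (csnd n)) t).
pose tbl z n := nat_rect (fun=> nat) 0 (fun n t => cpair (S z n t) t) n.
have lookE z n i : i < n -> look n i (tbl z n) = S z i (tbl z i).
  rewrite /look; elim: n => // n IHn; rewrite ltnS leq_eqVlt => /predU1P[->|lt_in].
    by rewrite subSnn /= unpairE.
  have -> : (n.+1 - i).-1 = (n - i).-1.+1 by rewrite subSn 1?ltnW // prednK ?subn_gt0.
  by rewrite iterSr /= unpairE; apply: IHn.
have SE z n : S z n (tbl z n) = trec (F z) d n.
  have [m] := ubnP n; elim: m n => // m IHm n /ltnSE lenm.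
  rewrite /S; have [->//|n_gt0] := posnP n.
  have lt0 := ltn_csnd n_gt0.
  have lt1 : cfst (csnd n) < n by apply: leq_ltn_trans (leq_cfst _) lt0.
  have lt2 : csnd (csnd n) < n by apply: leq_ltn_trans (leq_csnd _) lt0.
  by rewrite !lookE // !IHm ?(leq_trans _ lenm) // (trecE _ _ n_gt0).
apply: (@eq_computable _ (fun z => S z (N z) (tbl z (N z)))) => [z|]; first by rewrite SE.
have lookc f g h : comp f -> comp g -> comp h -> comp (fun z => look (f z) (g z) (h z)).
  move=> fc gc hc; apply/computable_cfst/computable_iter => //; last by comp.
  by rewrite /computable2; comp.
have Sc : computable3 X S.
  apply: computable_if; first by apply: computable_eq0; comp.
    by apply: (computable_comp5 Fc); comp.
  by apply: (computable_comp5 Fc); try apply: lookc; comp.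
apply: (computable_comp3 Sc) => //; first by comp.
apply: (@computable_rec _ _ (fun z n t => cpair (S z n t) t)) => //; first by comp.
by apply: computable_cpair => //; comp.
Qed.

Lemma computable_trec_bool (F : nat -> nat -> bool -> bool -> bool -> bool) d N :
  computable5 (fun z n a b c => F z n (a != 0) (b != 0) (c != 0)) -> comp N ->
  comp (fun z => trec (F z) d (N z)).
Proof.
move=> Fc Nc; have := computable_trec d Fc Nc; apply: eq_computable => z.
by apply: trec_morph => // n a b c; rewrite !eqb0 !negbK.
Qed.

End ComputableTrec.

(** * Computations with a time bound *)

Section Run.

Variable X : set nat.
Local Notation comp := (computable X).

(* [0] means that no value has been found within the bound [s] on the searches,
   and [r.+1] that the value is [r].  For a fixed program this is a total
   computable function, so no universal machine is needed. *)
Fixpoint run (p : program) (s n : nat) : nat :=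
  match p with
  | Zero => 1
  | Succ => n.+2
  | Fst => (cfst n).+1
  | Snd => (csnd n).+1
  | Oracle => `[< X n >].+1
  | Pair p q =>
      if (run p s n == 0) || (run q s n == 0) then 0
      else (cpair (run p s n).-1 (run q s n).-1).+1
  | Comp p q => if run q s n == 0 then 0 else run p s (run q s n).-1
  | Rec p q =>
      nat_rect (fun=> nat) (run p s (cfst n))
        (fun k r => if r == 0 then 0 else run q s (cpair (cfst n) (cpair k r.-1)))
        (csnd n)
  | Mu p =>
      let k := find (fun m => run p s (cpair n m) <= 1) (iota 0 s) in
      if (k < s) && (run p s (cpair n k) == 1) then k.+1 else 0
  end.

Lemma computable_run p : computable2 X (run p).
Proof.
elim: p => [|||||p IHp q IHq|p IHp q IHq|p IHp q IHq|p IHp] /=; rewrite /computable2 /=.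
- by comp.
- by comp.
- by comp.
- by comp.
- by apply/computable_succ/computable_oracle; comp.
- by comp.
- have := computable_comp2 IHp (computable_fst _) (computable_pred IHq).
  by move=> ?; comp.
- apply: (@computable_rec _ _ (fun z k r => if r == 0 then 0 else
    run q (cfst z) (cpair (cfst (csnd z)) (cpair k r.-1)))); last by comp.
    by apply: (computable_comp2 IHp); comp.
  apply: computable_if; first by apply: computable_eqn; comp.
    by comp.
  by apply: (computable_comp2 IHq); comp.
- have kc : comp (fun z => find (fun m => run p (cfst z) (cpair (csnd z) m) <= 1)
                                (iota 0 (cfst z))).
    apply: computable_find; last by comp.
    apply: computable_leq; last by comp.
    by apply: (computable_comp2 IHp); comp.
  have := computable_comp2 IHp (computable_fst _)
    (computable_cpair (computable_snd _) kc).
  by move=> ?; comp.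
Qed.

(** The bounded search stops at the first argument where [p] yields no value (code 0) or the value 0
    (code 1). Only the latter is a success, hence the second test in [run]. *)
Lemma run_muP p s n r : reflect
  [/\ r < s, run p s (cpair n r) = 1 & forall m, m < r -> 1 < run p s (cpair n m)]
  (run (Mu p) s n == r.+1).
Proof.
rewrite /=; set P := fun m => _; set k := find P _.
apply: (iffP idP) => [|[lt_rs rE minr]].
  case: ifP => // /andP[lt_ks /eqP runk] /eqP[<-]; split=> // m lt_mk.
  have := before_find 0 lt_mk; rewrite nth_iota ?add0n /P; last exact: ltn_trans lt_ks.
  by move/negbT; rewrite -ltnNge.
have Pr : P r by rewrite /P rE.
have kE : k = r.
  apply/eqP; rewrite eqn_leq; apply/andP; split; rewrite leqNgt; apply/negP => lt.
    by have := before_find 0 lt; rewrite nth_iota // add0n Pr.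
  have lt_ks := ltn_trans lt lt_rs.
  have: has P (iota 0 s) by rewrite has_find size_iota.
  move/(nth_find 0); rewrite -/k nth_iota // add0n /P.
  by rewrite leqNgt minr.
by rewrite kE lt_rs rE /= eqxx.
Qed.

Lemma run_leq p s s' n r : s <= s' -> run p s n = r.+1 -> run p s' n = r.+1.
Proof.
move=> le_ss'; elim: p n r => [|||||p IHp q IHq|p IHp q IHq|p IHp q IHq|p IHp] n r //.
- rewrite /=; case Ep: (run p s n) => [//|a]; case Eq: (run q s n) => [//|b] /=.
  by rewrite (IHp _ _ Ep) (IHq _ _ Eq).
- by rewrite /=; case Eq: (run q s n) => [//|a] /= /IHp; rewrite (IHq _ _ Eq).
- rewrite /=; elim: (csnd n) r => [|k IHk] r /=; first exact: IHp.
  case E: (nat_rect _ _ _ k) => [//|a] /=.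
  by rewrite (IHk _ E) => /IHq.
- move=> /eqP/run_muP[lt_rs runr minr]; apply/eqP/run_muP; split.
  + exact: leq_trans le_ss'.
  + exact: IHp.
  + move=> m /minr; case E: (run p s (cpair n m)) => [//|[//|a]] _.
    by rewrite (IHp _ _ E).
Qed.

Lemma run_sound p s n r : run p s n = r.+1 -> eval X p n r.
Proof.
elim: p n r => [|||||p IHp q IHq|p IHp q IHq|p IHp q IHq|p IHp] n r.
- by move=> [<-]; constructor.
- by move=> [<-]; constructor.
- by move=> [<-]; rewrite -{1}(unpairK n); constructor.
- by move=> [<-]; rewrite -{1}(unpairK n); constructor.
- by move=> [<-]; case: asboolP => Xn; constructor.
- rewrite /=; case Ep: (run p s n) => [//|a]; case Eq: (run q s n) => [//|b] /= [<-].
  by constructor; [apply: IHp | apply: IHq].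
- rewrite /=; case Eq: (run q s n) => [//|a] /= /IHp; apply: eval_comp; exact: IHq.
- rewrite /= -{4}(unpairK n); elim: (csnd n) r => [|k IHk] r /=.
    by move/IHp; apply: eval_rec0.
  case E: (nat_rect _ _ _ k) => [//|a] /= /IHq; apply: eval_recS; exact: IHk.
- move/eqP/run_muP => [_ runr minr].
  (* One predecessor undoes the coding of [run], the other one is asked for by [eval_mu]. *)
  apply: (@eval_mu _ _ _ _ (fun m => (run p s (cpair n m)).-2)); last exact: IHp.
  by move=> m /minr; case E: (run p s (cpair n m)) => [//|[//|a]] _; apply: IHp.
Qed.

Lemma run_complete p n r : eval X p n r -> exists s, run p s n = r.+1.
Proof.
elim=> {p n r}.
- by exists 0.
- by exists 0.
- by move=> a b; exists 0; rewrite /= !unpairE.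
- by move=> a b; exists 0; rewrite /= !unpairE.
- by move=> n Xn; exists 0; rewrite /= asboolT.
- by move=> n Xn; exists 0; rewrite /= asboolF.
- move=> p q n a b _ [s1 E1] _ [s2 E2]; exists (maxn s1 s2) => /=.
  by rewrite (run_leq (leq_maxl _ _) E1) (run_leq (leq_maxr _ _) E2).
- move=> p q n a b _ [s1 E1] _ [s2 E2]; exists (maxn s1 s2) => /=.
  by rewrite (run_leq (leq_maxl _ _) E1) (run_leq (leq_maxr _ _) E2).
- by move=> p q a r _ [s E]; exists s; rewrite /= !unpairE.
- move=> p q a n r t _ [s1 E1] _ [s2 E2]; exists (maxn s1 s2).
  have := run_leq (leq_maxl _ s2) E1; rewrite /= !unpairE /= => ->.
  exact: run_leq (leq_maxr _ _) E2.
- move=> p a n r _ IH _ [s1 E1].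
  have [s2 E2] : exists s, forall m, m < n -> run p s (cpair a m) = (r m).+2.
    elim: n IH {E1} => [|n IHn] IH; first by exists 0.
    have [|s2 E2] := IHn; first by move=> m /ltnW/IH.
    have [s3 E3] := IH n (ltnSn n); exists (maxn s2 s3) => m.
    rewrite ltnS leq_eqVlt => /predU1P[->|lt_mn].
      exact: run_leq (leq_maxr _ _) E3.
    exact: run_leq (leq_maxl _ _) (E2 _ lt_mn).
  exists (maxn n.+1 (maxn s1 s2)); apply/eqP/run_muP; split.
  + by rewrite leq_max leqnn.
  + by apply: run_leq E1; rewrite leq_max (leq_maxl s1) orbT.
  + move=> m /E2 E; rewrite (@run_leq _ s2 _ _ (r m).+1) //.
    by rewrite leq_max (leq_maxr s1) orbT.
Qed.

(** Two derivations are compared through [run] at a common time bound, where the result is a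
    function value. *)
Lemma eval_functional p n r r' : eval X p n r -> eval X p n r' -> r = r'.
Proof.
move=> /run_complete[s E] /run_complete[s' E'].
by have := run_leq (leq_maxl s s') E; rewrite (run_leq (leq_maxr _ _) E') => -[].
Qed.

End Run.

(** * Relative computability *)

Fixpoint subst_oracle (q p : program) : program :=
  match p with
  | Oracle => q
  | Pair p1 p2 => Pair (subst_oracle q p1) (subst_oracle q p2)
  | Comp p1 p2 => Comp (subst_oracle q p1) (subst_oracle q p2)
  | Rec p1 p2 => Rec (subst_oracle q p1) (subst_oracle q p2)
  | Mu p1 => Mu (subst_oracle q p1)
  | _ => p
  end.

Lemma computable_turing_le (X Y : set nat) f :
  turing_le X Y -> computable X f -> computable Y f.
Proof.
move=> [q qP] [p pP]; exists (subst_oracle q p) => n; move: (f n) (pP n) => r.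
elim=> {p n r f pP} /=; try by constructor.
- by move=> n /(qP n).1.
- by move=> n /(qP n).2.
- by move=> p1 p2 n a b _ IH1 _ IH2; apply: eval_comp IH1 IH2.
- by move=> p1 p2 a n r s _ IH1 _ IH2; apply: eval_recS IH1 IH2.
- by move=> p a n r _ IH1 _ IH2; apply: eval_mu IH1 IH2.
Qed.

Lemma program_code_inj : injective program_code.
Proof.
elim=> [|||||p IHp q IHq|p IHp q IHq|p IHp q IHq|p IHp] [|||||p' q'|p' q'|p' q'|p'] //=;
  move/cpair_inj => [] // _; try by move/IHp->.
all: by move/cpair_inj => [/IHp-> /IHq->].
Qed.

(** The search is made into a program that halts exactly when it succeeds. Freezing its argument to
    [n] gives a program that ignores its input, so the diagonal question about its code, which is
    computable from [n], is the question asked. *)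
Lemma computable_zero_jump (P : nat -> nat -> bool) :
  computable2 set0 (fun n s => P n s) ->
  computable zero_jump (fun n => `[< exists s, P n s >]).
Proof.
move=> [p pP].
have [q qP] : exists q, forall n,
    (exists s, P n s) <-> (exists r, eval set0 q n r).
  have [neg negP] : computable set0 (fun z => z == 0) by apply: computable_eqn; comp.
  exists (Mu (Comp neg p)) => n; split=> [Pn|[r]].
    exists (ex_minn Pn); case: ex_minnP => m Pm minm.
    have evm k : eval set0 (Comp neg p) (cpair n k) (~~ P n k).
      have -> : (~~ P n k : nat) = (nat_of_bool (P n k) == 0) by case: (P n k).
      apply: eval_comp (negP _).
      by have := pP (cpair n k); rewrite !unpairE.
    apply: (@eval_mu _ _ _ _ (fun=> 0)) => [k ltk|]; last by have := evm m; rewrite Pm.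
    have := evm k; case: (boolP (P n k)) => // /minm.
    by rewrite leqNgt ltk.
  move=> ev; inversion ev as [| | | | | | | | | |? ? ? ? _ E]; exists r.
  inversion E as [| | | | | | |? ? ? b ? E1 E2| | |]; subst.
  have := pP (cpair n r); rewrite !unpairE => E1'.
  have bE := eval_functional E1 E1'; subst.
  have := eval_functional E2 (negP _).
  by case: (P n r).
pose K n := nat_rect (fun=> program) Zero (fun _ r => Comp Succ r) n.
have evK n k : eval set0 (K n) k n.
  by elim: n => [|n IHn] /=; [constructor | apply: eval_comp IHn _; constructor].
pose h n := program_code (Comp q (K n)).
have hc : computable zero_jump h.
  rewrite /h /=; apply: computable_cpair; first by comp.
  apply: computable_cpair; first by comp.
  apply: (@eq_computable _ (fun n => nat_rect (fun=> nat) (program_code Zero)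
    (fun _ r => cpair 6 (cpair (program_code Succ) r)) n)).
    by elim=> //= n ->.
  apply: (@computable_rec _ _ (fun _ _ r => cpair 6 (cpair (program_code Succ) r)));
    by comp.
have := computable_oracle hc; apply: eq_computable => n; congr (nat_of_bool _).
apply: asbool_equiv_eq; rewrite qP /zero_jump /jump /=.
split=> [[r ev]|[p' [r [codeE ev]]]].
  by exists (Comp q (K n)), r; split=> //; apply: eval_comp ev.
move: codeE ev => /program_code_inj -> ev; exists r.
inversion ev as [| | | | | | |? ? ? b ? E1 E2| | |]; subst.
by rewrite -(eval_functional E1 (evK _ _)).
Qed.

(* The modulus of the enumeration: if [f] dominated it, [f] would bound the
   stage at which the elements of [A] get enumerated. *)
Lemma ce_escape (X A : set nat) : ce_in X A -> turing_le X A -> ~ turing_le A X ->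
  exists g : nat -> nat,
    [/\ computable A g, {homo g : m n / m <= n} &
        forall f s, computable X f -> exists2 t, s <= t & f t < g t].
Proof.
move=> [p pP] leXA nleAX; pose T i s := run X p s i != 0.
have Tc : computable2 X T.
  apply/computable_negb/computable_eqn; last by comp.
  by apply: (computable_comp2 (computable_run X p)); comp.
have Tleq i s s' : s <= s' -> T i s -> T i s'.
  by rewrite /T => le_s; case E: (run X p s i) => [//|r]; rewrite (run_leq le_s E).
have AP i : A i <-> exists s, T i s.
  rewrite pP; split=> [[r /run_complete[s E]]|[s]]; first by exists s; rewrite /T E.
  by rewrite /T; case E: (run X p s i) => [//|r] _; exists r; apply: run_sound E.
(* The modulus at [n] is the least stage by which [A] up to [n] has been enumerated; with [A] as an
   oracle a stage can be tested for this. *)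
pose P n s := all (fun i => ~~ `[< A i >] || T i s) (iota 0 n.+1).
have PP n s : reflect (forall i, i <= n -> A i -> T i s) (P n s).
  apply: (iffP allP) => [H i le_in Ai|H i].
    by have := H i; rewrite mem_iota add0n ltnS le_in asboolT //; apply.
  rewrite mem_iota ltnS => /= /H; case: asboolP => //= Ai; exact.
have exP n : exists s, P n s.
  elim: n => [|n [s /PP Ps]].
    have [/AP[s Ts]|nA] := pselect (A 0).
      by exists s; apply/PP => i; rewrite leqn0 => /eqP->.
    by exists 0; apply/PP => i; rewrite leqn0 => /eqP->.
  have [/AP[s' Ts']|nA] := pselect (A n.+1); last first.
    by exists s; apply/PP => i; rewrite leq_eqVlt ltnS => /predU1P[->//|]; apply: Ps.
  exists (maxn s s'); apply/PP => i; rewrite leq_eqVlt ltnS => /predU1P[->|le_in] Ai.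
    exact: Tleq (leq_maxr _ _) Ts'.
  by apply: Tleq (leq_maxl _ _) (Ps _ le_in Ai).
pose g n := ex_minn (exP n); exists g.
have Pg n : P n (g n) by rewrite /g; case: ex_minnP.
have gmin n s : P n s -> g n <= s by rewrite /g; case: ex_minnP => m _; apply.
split.
- apply: (@computable_mu _ P) => //; last first.
    by move=> n m lt_m; apply/negP => /gmin; rewrite leqNgt lt_m.
  apply/computable_negb/computable_all; last by comp.
  apply: computable_orb; first by apply/computable_negb/computable_oracle; comp.
  by apply: (computable_comp2 (computable_turing_le leXA Tc)); comp.
- move=> m n le_mn; apply: gmin; apply/PP => i le_im; apply: (PP n _ (Pg n)).
  exact: leq_trans le_mn.
- move=> f s fc; apply: contrapT => nlt; apply: nleAX; apply/turing_leP.
  have le_gf t : s <= t -> g t <= f t.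
    by move=> le_st; rewrite leqNgt; apply/negP => lt; apply: nlt; exists t.
  (* Domination is known only from [s] on; the modulus at the larger argument [m i] still covers
     [i]. *)
  pose m i := if s < i then i else s.
  have mc : computable X m by apply: computable_if; [apply: computable_leq| |]; comp.
  have mE i : m i = maxn s i by [].
  have := computable_comp2 Tc (computable_id X) (computable_comp fc mc).
  apply: eq_computable => i; congr nat_of_bool; apply/asboolP/idP => [Ai|Ti].
    apply: (Tleq _ (g (m i))); first by rewrite le_gf // mE leq_maxl.
    by apply: (PP _ _ (Pg (m i))) => //; rewrite mE leq_maxr.
  by apply/AP; exists (f (m i)).
Qed.

(** * Terms and formulas as numbers *)

Lemma cpair_gt0 a b : 0 < a -> 0 < cpair a b.
Proof. by move=> a_gt0; apply: leq_trans (leq_cpairl a b). Qed.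

Lemma cpair00 : cpair 0 0 = 0.
Proof. by rewrite cpairE. Qed.

Lemma cfst0 : cfst 0 = 0.
Proof. by rewrite -cpair00 unpairE. Qed.

Lemma csnd0 : csnd 0 = 0.
Proof. by rewrite -cpair00 unpairE. Qed.

Lemma trec_cpair T (F : nat -> T -> T -> T -> T) d a b : 0 < a ->
  trec F d (cpair a b) =
    F (cpair a b) (trec F d b) (trec F d (cfst b)) (trec F d (csnd b)).
Proof. by move=> a_gt0; rewrite (trecE F d (cpair_gt0 b a_gt0)) !unpairE. Qed.

Lemma trec_cpair0 T (F : nat -> T -> T -> T -> T) d f :
  (forall n a b c, cfst n = 0 -> F n a b c = f (csnd n)) ->
  forall k, trec F d (cpair 0 k) = f k.
Proof.
move=> FE k; have [->|k_gt0] := posnP k; first by rewrite cpair00 trec0 FE ?csnd0 ?cfst0.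
by rewrite trecE ?FE ?unpairE // (leq_trans k_gt0) ?leq_cpairr.
Qed.

(* Names: [cpair 0 k] denotes the same element as [k], which makes every element
   the value of a constant; [cpair 1 0], [cpair 2 (cpair a b)] and [cpair 3 a]
   are the unit, products and inverses, in accordance with [term_code]; all
   other numbers are free generators. *)
Definition name_val T (one : T) (mul : T -> T -> T) (inv : T -> T) (g : nat -> T) :
    nat -> T :=
  trec (fun n a b c =>
    if cfst n == 0 then (if n == 0 then g 0 else a)
    else if cfst n == 1 then (if csnd n == 0 then one else g n)
    else if cfst n == 2 then mul b c
    else if cfst n == 3 then inv a else g n) one.

Section NameVal.

Variables (T : Type) (one : T) (mul : T -> T -> T) (inv : T -> T) (g : nat -> T).
Local Notation V := (name_val one mul inv g).

Lemma name_val_var k : V (cpair 0 k) = V k.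
Proof.
have [->|k_gt0] := posnP k; first by rewrite cpair00.
by rewrite /name_val trecE ?unpairE /= ?gtn_eqF // (leq_trans k_gt0) ?leq_cpairr.
Qed.

Lemma name_val_one : V (cpair 1 0) = one.
Proof. by rewrite /name_val trec_cpair // !unpairE. Qed.

Lemma name_val_mul a b : V (cpair 2 (cpair a b)) = mul (V a) (V b).
Proof. by rewrite /name_val trec_cpair // !unpairE. Qed.

Lemma name_val_inv a : V (cpair 3 a) = inv (V a).
Proof. by rewrite /name_val trec_cpair // !unpairE. Qed.

Lemma name_val_gen a b : 3 < a -> V (cpair a b) = g (cpair a b).
Proof.
by move=> a_gt3; rewrite /name_val trec_cpair ?(leq_trans _ a_gt3) // !unpairE;
  case: a a_gt3 => [|[|[|[|a]]]].
Qed.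

End NameVal.

(** The tags are those of [qf_code], so the code of a formula is itself a propositional formula,
    with the equation of [a] and [b] as the atom [cpair a b]. The remaining tags count as true,
    which provides [ftrue]. *)
Definition ev (delta : nat -> bool) : nat -> bool :=
  trec (fun n a b c =>
    if cfst n == 0 then delta (csnd n) else if cfst n == 1 then ~~ a
    else if cfst n == 2 then b && c else if cfst n == 3 then b || c else true) true.

Definition sub_term (v : nat -> nat) : nat -> nat :=
  trec (fun n a b c =>
    if cfst n == 0 then v (csnd n) else if cfst n == 2 then cpair 2 (cpair b c)
    else if cfst n == 3 then cpair 3 a else n) 0.

Definition sub_qf (v : nat -> nat) : nat -> nat :=
  trec (fun n a b c =>
    if cfst n == 0 then
      cpair 0 (cpair (sub_term v (cfst (csnd n))) (sub_term v (csnd (csnd n))))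
    else if cfst n == 1 then cpair 1 a else if cfst n == 2 then cpair 2 (cpair b c)
    else if cfst n == 3 then cpair 3 (cpair b c) else n) 0.

Definition is_term (P : nat -> bool) : nat -> bool :=
  trec (fun n a b c =>
    if cfst n == 0 then P (csnd n) else if cfst n == 1 then csnd n == 0
    else if cfst n == 2 then b && c else if cfst n == 3 then a else false) true.

Definition is_qf (P : nat -> bool) : nat -> bool :=
  trec (fun n a b c =>
    if cfst n == 0 then is_term P (cfst (csnd n)) && is_term P (csnd (csnd n))
    else if cfst n == 1 then a else if cfst n == 2 then b && c
    else if cfst n == 3 then b && c else false) true.

Local Ltac tag0 := apply: trec_cpair0 => n a b c ->.
Local Ltac tagS := rewrite trec_cpair // !unpairE.

Section FormulaEquations.

Variables (delta P : nat -> bool) (v : nat -> nat).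

Lemma ev_atom k : ev delta (cpair 0 k) = delta k.
Proof. by tag0. Qed.
Lemma ev_not a : ev delta (cpair 1 a) = ~~ ev delta a.
Proof. by rewrite /ev; tagS. Qed.
Lemma ev_and a b : ev delta (cpair 2 (cpair a b)) = ev delta a && ev delta b.
Proof. by rewrite /ev; tagS. Qed.
Lemma ev_or a b : ev delta (cpair 3 (cpair a b)) = ev delta a || ev delta b.
Proof. by rewrite /ev; tagS. Qed.
Lemma ev_true a : ev delta (cpair 4 a) = true.
Proof. by rewrite /ev; tagS. Qed.

Definition evE := (ev_atom, ev_not, ev_and, ev_or, ev_true).

Lemma sub_term_var k : sub_term v (cpair 0 k) = v k.
Proof. by tag0. Qed.
Lemma sub_term_one : sub_term v (cpair 1 0) = cpair 1 0.
Proof. by rewrite /sub_term; tagS. Qed.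
Lemma sub_term_mul a b :
  sub_term v (cpair 2 (cpair a b)) = cpair 2 (cpair (sub_term v a) (sub_term v b)).
Proof. by rewrite /sub_term; tagS. Qed.
Lemma sub_term_inv a : sub_term v (cpair 3 a) = cpair 3 (sub_term v a).
Proof. by rewrite /sub_term; tagS. Qed.

Lemma sub_qf_eq a b :
  sub_qf v (cpair 0 (cpair a b)) = cpair 0 (cpair (sub_term v a) (sub_term v b)).
Proof.
rewrite -{2}(cfst_cpair a b) -{3}(csnd_cpair a b).
apply: (@trec_cpair0 _ _ _
  (fun k => cpair 0 (cpair (sub_term v (cfst k)) (sub_term v (csnd k))))).
by move=> n x y z ->.
Qed.
Lemma sub_qf_not a : sub_qf v (cpair 1 a) = cpair 1 (sub_qf v a).
Proof. by rewrite /sub_qf; tagS. Qed.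
Lemma sub_qf_and a b :
  sub_qf v (cpair 2 (cpair a b)) = cpair 2 (cpair (sub_qf v a) (sub_qf v b)).
Proof. by rewrite /sub_qf; tagS. Qed.
Lemma sub_qf_or a b :
  sub_qf v (cpair 3 (cpair a b)) = cpair 3 (cpair (sub_qf v a) (sub_qf v b)).
Proof. by rewrite /sub_qf; tagS. Qed.

Lemma is_term_var k : is_term P (cpair 0 k) = P k.
Proof. by tag0. Qed.
Lemma is_term_const k : is_term P (cpair 1 k) = (k == 0).
Proof. by rewrite /is_term; tagS. Qed.
Lemma is_term_mul k : is_term P (cpair 2 k) = is_term P (cfst k) && is_term P (csnd k).
Proof. by rewrite /is_term; tagS. Qed.
Lemma is_term_inv k : is_term P (cpair 3 k) = is_term P k.
Proof. by rewrite /is_term; tagS. Qed.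
Lemma is_term_junk a k : is_term P (cpair a.+4 k) = false.
Proof. by rewrite /is_term; tagS. Qed.

Lemma is_qf_eq k : is_qf P (cpair 0 k) = is_term P (cfst k) && is_term P (csnd k).
Proof.
by apply: (@trec_cpair0 _ _ _
  (fun k => is_term P (cfst k) && is_term P (csnd k))) => n a b c ->.
Qed.
Lemma is_qf_not k : is_qf P (cpair 1 k) = is_qf P k.
Proof. by rewrite /is_qf; tagS. Qed.
Lemma is_qf_and k : is_qf P (cpair 2 k) = is_qf P (cfst k) && is_qf P (csnd k).
Proof. by rewrite /is_qf; tagS. Qed.
Lemma is_qf_or k : is_qf P (cpair 3 k) = is_qf P (cfst k) && is_qf P (csnd k).
Proof. by rewrite /is_qf; tagS. Qed.
Lemma is_qf_junk a k : is_qf P (cpair a.+4 k) = false.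
Proof. by rewrite /is_qf; tagS. Qed.

End FormulaEquations.

Definition is_termE :=
  (is_term_var, is_term_const, is_term_mul, is_term_inv, is_term_junk).
Definition is_qfE := (is_qf_eq, is_qf_not, is_qf_and, is_qf_or, is_qf_junk).

Section ComputableFormulas.

Variable X : set nat.
Local Notation comp := (computable X).

Lemma computable_ev (delta : nat -> nat -> bool) N :
  computable2 X (fun z k => delta z k) -> comp N -> comp (fun z => ev (delta z) (N z)).
Proof.
move=> /computable_comp2 dc Nc; apply: computable_trec_bool Nc.
by rewrite /computable5; comp.
Qed.

Lemma computable_sub_term (v : nat -> nat -> nat) N :
  computable2 X v -> comp N -> comp (fun z => sub_term (v z) (N z)).
Proof.
move=> /computable_comp2 vc Nc; apply: computable_trec Nc.
by rewrite /computable5; comp.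
Qed.

Lemma computable_sub_qf (v : nat -> nat -> nat) N :
  computable2 X v -> comp N -> comp (fun z => sub_qf (v z) (N z)).
Proof.
move=> vc Nc; apply: computable_trec Nc; rewrite /computable5.
have : computable2 X (fun z k => sub_term (v z) k).
  apply: (@computable_sub_term (fun z => v (cfst z))); last by comp.
  by apply: (computable_comp2 vc); comp.
by move=> /computable_comp2 sc; comp.
Qed.

Lemma computable_is_term (P : nat -> nat -> bool) N :
  computable2 X (fun z k => P z k) -> comp N -> comp (fun z => is_term (P z) (N z)).
Proof.
move=> /computable_comp2 Pc Nc; apply: computable_trec_bool Nc.
by rewrite /computable5; comp.
Qed.

Lemma computable_is_qf (P : nat -> nat -> bool) N :
  computable2 X (fun z k => P z k) -> comp N -> comp (fun z => is_qf (P z) (N z)).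
Proof.
move=> Pc Nc; apply: computable_trec_bool Nc; rewrite /computable5.
have : computable2 X (fun z k => is_term (P z) k).
  apply: (@computable_is_term (fun z => P (cfst z))); last by comp.
  by apply: (computable_comp2 Pc); comp.
by move=> /computable_comp2 tc; comp.
Qed.

End ComputableFormulas.

Lemma ev_agree delta delta' c :
  (forall k, k <= c -> delta k = delta' k) -> ev delta c = ev delta' c.
Proof.
have [m] := ubnP c; elim: m c => // m IHm c /ltnSE lecm eq_d.
have [->|c_gt0] := posnP c; first by rewrite /ev !trec0 cfst0 csnd0 eq_d.
rewrite /ev !(trecE _ _ c_gt0) -/(ev _) -/(ev _) (eq_d _ (leq_csnd c)).
have lt0 := ltn_csnd c_gt0.
have lt1 : cfst (csnd c) < c by apply: leq_ltn_trans (leq_cfst _) lt0.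
have lt2 : csnd (csnd c) < c by apply: leq_ltn_trans (leq_csnd _) lt0.
have IH k : k < c -> ev delta k = ev delta' k.
  move=> lt_kc; apply: IHm => [|i le_ik]; first exact: leq_trans lecm.
  exact/eq_d/(leq_trans le_ik)/ltnW.
by rewrite !IH.
Qed.

(** * Satisfiability *)

Definition bit (s k : nat) : bool := odd (iter k half s).

Lemma bitsP (delta : nat -> bool) n :
  exists2 s, s < 2 ^ n & forall k, k < n -> bit s k = delta k.
Proof.
elim: n delta => [|n IHn] delta; first by exists 0.
have [s lt_s sE] := IHn (delta \o succn); exists (delta 0 + s.*2).
  rewrite expnS mul2n; apply: (@leq_trans s.+1.*2); last by rewrite leq_double.
  by rewrite doubleS ltnS -add1n leq_add2r; case: (delta 0).
case=> [|k]; rewrite ltnS => lt_kn.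
  by rewrite /bit /= oddD odd_double addbF; case: (delta 0).
by rewrite /bit iterSr half_bit_double; apply: sE.
Qed.

(** No atom of [c] exceeds [c], so the [c.+1] low bits of [s] run through all relevant
    assignments. *)
Definition satisfiable c := has (fun s => ev (bit s) c) (iota 0 (2 ^ c.+1)).

Lemma satisfiableP c : reflect (exists delta, ev delta c) (satisfiable c).
Proof.
apply: (iffP hasP) => [[s _ evs]|[delta evd]]; first by exists (bit s).
have [s lt_s sE] := bitsP delta c.+1; exists s; first by rewrite mem_iota.
by rewrite (@ev_agree _ delta).
Qed.

Lemma computable_satisfiable X f :
  computable X f -> computable X (fun z => satisfiable (f z)).
Proof.
move=> fc; apply: (@computable_comp _ (fun z => satisfiable z) f _ fc).
apply: computable_has; last by comp.
apply: computable_ev; last by comp.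
apply: computable_odd; apply: (@computable_iter _ (fun _ => half)); comp.
Qed.

(** * Group axioms as propositional formulas over equations between names *)

Definition fand a b := cpair 2 (cpair a b).
Definition fnot a := cpair 1 a.
Definition fimp a b := cpair 3 (cpair (cpair 1 a) b).
Definition feq a b := cpair 0 (cpair a b).
Definition ftrue := cpair 4 0.
Definition nmul a b := cpair 2 (cpair a b).
Definition ninv a := cpair 3 a.
Definition none := cpair 1 0.

Lemma ev_imp delta a b : ev delta (fimp a b) = (ev delta a ==> ev delta b).
Proof. by rewrite !evE implybE. Qed.

(** The number [i] codes four names, and all laws are instantiated at them: equality is a
    congruence, the group laws hold, and the constant [cpair 0 a] is identified with [a]. *)
Definition group_axiom i :=
  let a := cfst i in let b := cfst (csnd i) in
  let c := cfst (csnd (csnd i)) in let d := csnd (csnd (csnd i)) in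
  foldr fand ftrue [::
    feq a a; fimp (feq a b) (feq b a); fimp (feq a b) (fimp (feq b c) (feq a c));
    fimp (feq a b) (fimp (feq c d) (feq (nmul a c) (nmul b d)));
    fimp (feq a b) (feq (ninv a) (ninv b));
    feq (nmul a (nmul b c)) (nmul (nmul a b) c);
    feq (nmul none a) a; feq (nmul a none) a;
    feq (nmul (ninv a) a) none; feq (nmul a (ninv a)) none; feq (cpair 0 a) a].

Lemma ev_foldr_and delta s : ev delta (foldr fand ftrue s) = all (ev delta) s.
Proof. by elim: s => [|a s IHs] /=; rewrite /ftrue /fand !evE // IHs. Qed.

Record group_diagram (delta : nat -> bool) (E := fun a b => delta (cpair a b)) : Prop :=
  GroupDiagram {
    diag_refl : forall a, E a a;
    diag_sym : forall a b, E a b -> E b a;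
    diag_trans : forall a b c, E a b -> E b c -> E a c;
    diag_mul : forall a b c d, E a b -> E c d -> E (nmul a c) (nmul b d);
    diag_inv : forall a b, E a b -> E (ninv a) (ninv b);
    diag_mulA : forall a b c, E (nmul a (nmul b c)) (nmul (nmul a b) c);
    diag_mul1 : forall a, E (nmul none a) a;
    diag_mulr1 : forall a, E (nmul a none) a;
    diag_mulV : forall a, E (nmul (ninv a) a) none;
    diag_mulrV : forall a, E (nmul a (ninv a)) none;
    diag_var : forall a, E (cpair 0 a) a }.

Lemma group_axiomP delta : (forall i, ev delta (group_axiom i)) <-> group_diagram delta.
Proof.
split=> [ax|[]].
  pose E a b := delta (cpair a b).
  have {}ax a b c d : [/\ E a a, E a b -> E b a, E a b -> E b c -> E a c &
    E a b -> E c d -> E (nmul a c) (nmul b d)] /\ [/\ E a b -> E (ninv a) (ninv b),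
    E (nmul a (nmul b c)) (nmul (nmul a b) c), E (nmul none a) a & E (nmul a none) a] /\
    [/\ E (nmul (ninv a) a) none, E (nmul a (ninv a)) none & E (cpair 0 a) a].
    have := ax (cpair a (cpair b (cpair c d))).
    rewrite /group_axiom !unpairE ev_foldr_and /= !ev_imp /feq !evE -/(E _ _).
    case/andP=> h1 /andP[h2] /andP[h3] /andP[h4] /andP[h5] /andP[h6] /andP[h7].
    case/andP=> h8 /andP[h9] /andP[h10] /andP[h11 _].
    split; [split=> //|split; split=> //].
    - exact/implyP.
    - by move=> Eab; apply/implyP; apply: (implyP h3).
    - by move=> Eab; apply/implyP; apply: (implyP h4).
    - exact/implyP.
  split=> [a|a b|a b c|a b c d|a b|a b c|a|a|a|a|a]; rewrite -/(E _ _).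
  - by have [[]] := ax a 0 0 0.
  - by have [[]] := ax a b 0 0.
  - by have [[]] := ax a b c 0.
  - by have [[]] := ax a b c d.
  - by have [_ [[]]] := ax a b 0 0.
  - by have [_ [[]]] := ax a b c 0.
  - by have [_ [[]]] := ax a 0 0 0.
  - by have [_ [[]]] := ax a 0 0 0.
  - by have [_ [_ []]] := ax a 0 0 0.
  - by have [_ [_ []]] := ax a 0 0 0.
  - by have [_ [_ []]] := ax a 0 0 0.
move=> h1 h2 h3 h4 h5 h6 h7 h8 h9 h10 h11 i.
rewrite /group_axiom ev_foldr_and /= !ev_imp /feq !evE h1 h6 h7 h8 h9 h10 h11 /= !andbT.
apply/and4P; split.
- by apply/implyP; apply: h2.
- by apply/implyP => ?; apply/implyP; apply: h3.
- by apply/implyP => ?; apply/implyP; apply: h4.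
- by apply/implyP; apply: h5.
Qed.

Definition group_axioms s :=
  nat_rect (fun=> nat) ftrue (fun i r => fand r (group_axiom i)) s.

Lemma ev_group_axioms delta s :
  reflect (forall i, i < s -> ev delta (group_axiom i)) (ev delta (group_axioms s)).
Proof.
elim: s => [|s IHs] /=; first by rewrite evE; constructor.
rewrite /fand evE; apply: (iffP andP) => [[/IHs H Hs] i|H].
  by rewrite ltnS leq_eqVlt => /predU1P[->//|/H].
by split; [apply/IHs => i lt_is; apply/H/ltnW | apply: H].
Qed.

(* By compactness, satisfiability in a group, stated as a co-c.e. condition. *)
Definition consistent p := forall s, satisfiable (fand p (group_axioms s)).

Lemma computable_consistent : computable zero_jump (fun p => `[< consistent p >]).
Proof.
have axc X : computable X group_axioms.
  apply: (@computable_rec _ _ (fun _ i r => fand r (group_axiom i))); try by comp.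
  rewrite /computable3 /fand /group_axiom /=.
  by rewrite /fimp /feq /nmul /ninv /none /ftrue /fand; comp.
have : computable2 set0 (fun p s => ~~ satisfiable (fand p (group_axioms s))).
  apply/computable_negb/computable_satisfiable; rewrite /fand.
  apply: computable_cpair; first by comp.
  apply: computable_cpair; first by comp.
  by apply: (computable_comp (axc _)); comp.
move/computable_zero_jump/computable_negb; apply: eq_computable => p.
rewrite -asbool_neg; congr nat_of_bool; apply: asbool_equiv_eq; split=> [cp [s]|ncp s].
  by rewrite cp.
by apply: contrapT => /negP ns; apply: ncp; exists s.
Qed.

Definition entails p q := forall delta, ev delta p -> ev delta q.

Lemma consistent_diagram delta p : group_diagram delta -> ev delta p -> consistent p.
Proof.
move=> /group_axiomP ax pd s; apply/satisfiableP; exists delta.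
by rewrite /fand evE pd; apply/ev_group_axioms.
Qed.

(** This carries the compactness argument. If both extensions fail, each fails against finitely many
    axioms; but an assignment satisfying [p] and the longer of the two lists gives [q] some truth
    value. *)
Lemma consistent_split p q : consistent p ->
  consistent (fand p q) \/ consistent (fand p (fnot q)).
Proof.
move=> cp; apply: contrapT => /not_orP[nq nnq].
have [s1 /negP ns1] : exists s, ~ satisfiable (fand (fand p q) (group_axioms s)).
  by apply: contrapT => H; apply: nq => s; apply: contrapT => ?; apply: H; exists s.
have [s2 /negP ns2] : exists s, ~ satisfiable (fand (fand p (fnot q)) (group_axioms s)).
  by apply: contrapT => H; apply: nnq => s; apply: contrapT => ?; apply: H; exists s.
have /satisfiableP[delta] := cp (maxn s1 s2).
rewrite /fand evE => /andP[pd /ev_group_axioms ax].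
have ax' s : s <= maxn s1 s2 -> ev delta (group_axioms s).
  by move=> le_s; apply/ev_group_axioms => i lt_i; apply/ax/(leq_trans lt_i).
case: (boolP (ev delta q)) => dq.
  move/negP: ns1; apply; apply/satisfiableP; exists delta.
  by rewrite /fand !evE pd dq ax' ?leq_maxl.
move/negP: ns2; apply; apply/satisfiableP; exists delta.
by rewrite /fand /fnot !evE pd dq ax' ?leq_maxr.
Qed.

(** * Interpretations of names in groups *)

Record interp (G : groupType) (V : nat -> G) : Prop := Interp {
  interp_one : V none = 1%g;
  interp_mul : forall a b, V (nmul a b) = (V a * V b)%g;
  interp_inv : forall a, V (ninv a) = (V a)^-1%g;
  interp_var : forall a, V (cpair 0 a) = V a }.

Definition diag (G : groupType) (V : nat -> G) (k : nat) : bool :=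
  `[< V (cfst k) = V (csnd k) >].

Lemma diagP (G : groupType) (V : nat -> G) a b :
  reflect (V a = V b) (diag V (cpair a b)).
Proof. by rewrite /diag !unpairE; apply: asboolP. Qed.

Fixpoint term_map (V W : Type) (h : V -> W) (t : term V) : term W :=
  match t with
  | TVar i => TVar (h i)
  | TOne => TOne
  | TMul s t => TMul (term_map h s) (term_map h t)
  | TInv t => TInv (term_map h t)
  end.

Fixpoint qf_map (V W : Type) (h : V -> W) (phi : qf_formula V) : qf_formula W :=
  match phi with
  | QEq s t => QEq (term_map h s) (term_map h t)
  | QNot phi => QNot (qf_map h phi)
  | QAnd phi psi => QAnd (qf_map h phi) (qf_map h psi)
  | QOr phi psi => QOr (qf_map h phi) (qf_map h psi)
  end.

Lemma eval_term_map (G : groupType) (V W : Type) (h : V -> W) (v : W -> G) t :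
  eval_term v (term_map h t) = eval_term (v \o h) t.
Proof. by elim: t => //= [s -> t ->|t ->]. Qed.

Lemma qf_sat_map (G : groupType) (V W : Type) (h : V -> W) (v : W -> G) phi :
  qf_sat v (qf_map h phi) <-> qf_sat (v \o h) phi.
Proof.
elim: phi => [s t|phi IH|phi IH psi IH'|phi IH psi IH'] /=;
  by rewrite ?eval_term_map ?IH ?IH'.
Qed.

Section Embedding.

Variables (V : Type) (h : V -> nat) (P : nat -> bool).
Hypothesis hP : forall i, P i <-> exists x, h x = i.

Lemma is_termP c : is_term P c <-> exists t : term V, term_code (term_map h t) = c.
Proof.
split=> [|[t <-]]; last first.
  elim: t => [x||s IHs t IHt|t IHt] /=; rewrite is_termE ?unpairE ?IHs //.
  by apply/hP; exists x.
elim/code_ind: c => [|c _ IH0 IH1 IH2].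
  by rewrite -cpair00 is_termE => /hP[x E]; exists (TVar x); rewrite /= E.
rewrite -(unpairK c); case: (cfst c) => [|[|[|[|a]]]];
  rewrite is_termE.
- by move=> /hP[x <-]; exists (TVar x).
- by move/eqP->; exists TOne.
- case/andP => /IH1[s E1] /IH2[t E2]; exists (TMul s t).
  by rewrite /= E1 E2 unpairK.
- by move=> /IH0[t <-]; exists (TInv t).
- by [].
Qed.

Lemma is_qfP c : is_qf P c <-> exists phi : qf_formula V, qf_code (qf_map h phi) = c.
Proof.
split=> [|[phi <-]]; last first.
  elim: phi => [s t|phi IH|phi IH psi IH'|phi IH psi IH'] /=;
    rewrite is_qfE ?unpairE ?IH //.
  by apply/andP; split; apply/is_termP; [exists s|exists t].
elim/code_ind: c => [|c _ IH0 IH1 IH2].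
  (* The number 0 codes the equation of the term with code 0, the variable 0, with itself. *)
  rewrite -cpair00 is_qfE cfst0 csnd0 andbb => /is_termP[t E].
  by exists (QEq t t); rewrite /= E cpair00.
rewrite -(unpairK c); case: (cfst c) => [|[|[|[|a]]]];
  rewrite is_qfE.
- case/andP => /is_termP[s E1] /is_termP[t E2]; exists (QEq s t).
  by rewrite /= E1 E2 unpairK.
- by move=> /IH0[phi <-]; exists (QNot phi).
- case/andP => /IH1[s E1] /IH2[t E2]; exists (QAnd s t).
  by rewrite /= E1 E2 unpairK.
- case/andP => /IH1[s E1] /IH2[t E2]; exists (QOr s t).
  by rewrite /= E1 E2 unpairK.
- by [].
Qed.

End Embedding.

Section Interp.

Variables (G : groupType) (V : nat -> G).
Hypothesis iV : interp V.

Lemma interp_diagram : group_diagram (diag V).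
Proof.
have [V1 VM VV Vvar] := iV; split=> *; apply/diagP;
  rewrite ?VM ?VV ?V1 ?VM ?mulgA ?mul1g ?mulg1 ?mulVg ?mulgV //.
- by apply/esym/diagP.
- by apply: etrans; apply/diagP; eassumption.
- by congr (_ * _)%g; apply/diagP.
- by congr (_^-1)%g; apply/diagP.
Qed.

Lemma interp_sub_term (v : nat -> nat) t :
  V (sub_term v (term_code t)) = eval_term (V \o v) t.
Proof.
have [V1 VM VV Vvar] := iV.
elim: t => [i||s IHs t IHt|t IHt] /=.
- by rewrite sub_term_var.
- by rewrite sub_term_one.
- by rewrite sub_term_mul VM IHs IHt.
- by rewrite sub_term_inv VV IHt.
Qed.

Lemma interp_term t : V (term_code t) = eval_term V t.
Proof.
have [V1 VM VV Vvar] := iV.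
by elim: t => [i||s IHs t IHt|t IHt] //=; rewrite ?VM ?VV ?IHs ?IHt.
Qed.

Lemma ev_sub_qf (v : nat -> nat) phi :
  ev (diag V) (sub_qf v (qf_code phi)) <-> qf_sat (V \o v) phi.
Proof.
elim: phi => [s t|phi IH|phi IH psi IH'|phi IH psi IH'] /=.
- rewrite sub_qf_eq !evE -!interp_sub_term.
  by split=> /diagP.
- by rewrite sub_qf_not !evE -IH; split=> /negP.
- by rewrite sub_qf_and !evE -IH -IH'; split=> /andP.
- by rewrite sub_qf_or !evE -IH -IH'; split=> /orP.
Qed.

Lemma ev_qf phi : ev (diag V) (qf_code phi) <-> qf_sat V phi.
Proof.
elim: phi => [s t|phi IH|phi IH psi IH'|phi IH psi IH'] /=.
- by rewrite !evE -!interp_term; split=> /diagP.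
- by rewrite !evE -IH; split=> /negP.
- by rewrite !evE -IH -IH'; split=> /andP.
- by rewrite !evE -IH -IH'; split=> /orP.
Qed.

(** Deciding equations between names suffices: the truth of a sentence is evaluated from them
    propositionally, and [is_qf] screens off numbers that code no formula but may be accepted by
    [ev]. *)
Lemma computable_group_diag (A : set nat) : (forall x, exists i, V i = x) ->
  computable A (fun k => diag V k) -> computable_group A G.
Proof.
move=> surjV Vc; exists V; split=> //; apply/turing_leP.
have qfc : computable A (fun c => is_qf xpredT c).
  by apply: (@computable_is_qf _ (fun _ => xpredT)); comp.
have evc : computable A (fun c => ev (diag V) c).
  apply: (@computable_ev _ (fun _ => diag V)); last by comp.
  by apply: (computable_comp Vc); comp.
have := computable_andb qfc evc; apply: eq_computable => c.
congr nat_of_bool; apply/asboolP/andP => [[phi [<- satphi]]|[]].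
  split; last exact/ev_qf.
  apply/(@is_qfP _ id); first by move=> i; split=> // _; exists i.
  exists phi; congr qf_code.
  have term_id t : term_map id t = t by elim: t => //= [s -> t ->|t ->].
  by elim: {satphi}phi => //= [s t|phi ->|phi -> psi ->|phi -> psi ->]; rewrite ?term_id.
move/(@is_qfP _ id) => [i|phi <- /ev_qf satphi]; first by split=> // _; exists i.
by exists (qf_map id phi).
Qed.

End Interp.

Lemma eq_diag_le (G : groupType) (V V' : nat -> G) p :
  (forall n, n <= p -> V n = V' n) -> ev (diag V) p = ev (diag V') p.
Proof.
move=> VE; apply: ev_agree => k le_kp; rewrite /diag !VE //.
  exact: leq_trans (leq_csnd _) le_kp.
exact: leq_trans (leq_cfst _) le_kp.
Qed.

Definition group_val (G : groupType) (g : nat -> G) : nat -> G :=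
  name_val 1%g (fun a b => a * b)%g (fun a => a^-1)%g g.

Lemma interp_group_val (G : groupType) (g : nat -> G) : interp (group_val g).
Proof.
by split=> *; rewrite /group_val ?name_val_one ?name_val_mul ?name_val_inv ?name_val_var.
Qed.

(** The parts of a name never exceed it. Hence generators above [b] can be given new values without
    disturbing the names up to [b], which is what makes large generators fresh. *)
Lemma group_val_agree (G : groupType) (V g : nat -> G) b : interp V ->
  (forall n, n <= b -> g n = V n) -> forall n, n <= b -> group_val g n = V n.
Proof.
move=> [V1 VM VV Vvar] gE; elim/code_ind => [|n n_gt0 IH0 IH1 IH2] le_nb.
  by rewrite /group_val /name_val trec0 cfst0 /= gE.
have le0 := leq_trans (leq_csnd n) le_nb.
have {}IH0 := IH0 le0.
have {}IH1 := IH1 (leq_trans (leq_cfst _) le0).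
have {}IH2 := IH2 (leq_trans (leq_csnd _) le0).
move: le_nb; rewrite -(unpairK n).
case E: (cfst n) => [|[|[|[|a]]]] le_nb.
- by rewrite /group_val name_val_var Vvar.
- have [E0|E0] := eqVneq (csnd n) 0; first by rewrite E0 /group_val name_val_one.
  by rewrite /group_val /name_val trec_cpair // !unpairE (negPf E0) /= gE.
- by rewrite -(unpairK (csnd n)) /group_val name_val_mul VM -IH1 -IH2.
- by rewrite /group_val name_val_inv VV -IH0.
- by rewrite /group_val name_val_gen // gE.
Qed.

(** The term model: names modulo the equations of the diagram, each class being represented by its
    least member. *)
Lemma diagram_group (delta : nat -> bool) : group_diagram delta ->
  exists (G : groupType) (V : nat -> G),
    [/\ interp V, forall x, exists i, V i = x & forall k, diag V k = delta k].
Proof.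
pose E a b := delta (cpair a b); move=> dg.
have Erefl a : E a a := diag_refl dg a.
have Esym a b : E a b -> E b a := @diag_sym _ dg a b.
have Etrans a b c : E a b -> E b c -> E a c := @diag_trans _ dg a b c.
have exE a : exists b, E a b by exists a.
pose rep a := ex_minn (exE a).
have Erep a : E a (rep a) by rewrite /rep; case: ex_minnP.
have repE a b : (rep a == rep b) = E a b.
  apply/eqP/idP => [eq_ab|Eab].
    by apply: Etrans (Erep a) _; rewrite eq_ab; apply/Esym.
  rewrite /rep; case: ex_minnP => m Eam minm; case: ex_minnP => n Ebn minn.
  apply/eqP; rewrite eqn_leq minm ?minn //; last exact: Etrans Eab Ebn.
  exact: Etrans (Esym _ _ Eab) Eam.
have repK a : rep (rep a) == rep a by rewrite repE Esym.
pose car := {a | rep a == a}; pose V a : car := exist _ (rep a) (repK a).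
have VE a b : V a = V b <-> E a b.
  by rewrite -repE; split=> [/(congr1 val)/= ->//|/eqP eq_ab]; apply: val_inj.
have Vval x : V (val x) = x by apply: val_inj; apply/eqP/(valP x).
pose mul (x y : car) : car := V (nmul (val x) (val y)).
pose inv (x : car) : car := V (ninv (val x)).
have EV a : E (val (V a)) a by apply/Esym.
have mulE a b : mul (V a) (V b) = V (nmul a b).
  by apply/VE; apply: (diag_mul dg); apply: EV.
have invE a : inv (V a) = V (ninv a) by apply/VE; apply: (diag_inv dg); apply: EV.
have mulA : associative mul.
  move=> x y z; rewrite -(Vval x) -(Vval y) -(Vval z) !mulE.
  by apply/VE; apply: (diag_mulA dg).
have mul1 : left_id (V none) mul.
  by move=> x; rewrite -(Vval x) !mulE; apply/VE; apply: (diag_mul1 dg).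
have mul1' : right_id (V none) mul.
  by move=> x; rewrite -(Vval x) !mulE; apply/VE; apply: (diag_mulr1 dg).
have mulV : left_inverse (V none) inv mul.
  by move=> x; rewrite -(Vval x) invE !mulE; apply/VE; apply: (diag_mulV dg).
have mulV' : right_inverse (V none) inv mul.
  by move=> x; rewrite -(Vval x) invE !mulE; apply/VE; apply: (diag_mulrV dg).
pose G : groupType := HB.pack car (isGroup.Build car mulA mul1 mul1' mulV mulV').
exists G, V; split=> [|x|k].
- by split=> // a; apply/VE; apply: (diag_var dg).
- by exists (val x).
- by rewrite -{2}(unpairK k) -/(E _ _); apply/asboolP/idP => /VE.
Qed.

(** * Generic construction of existentially closed groups *)

(** Every number is read as an unending list, so no length is stored. *)
Definition lookup l i := cfst (iter i csnd l).

Lemma lookup_leq l i : lookup l i <= l.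
Proof.
rewrite /lookup; apply: leq_trans (leq_cfst _) _.
by elim: i => //= i; apply: leq_trans (leq_csnd _).
Qed.

Lemma lookup_ex (f : nat -> nat) k : exists l, forall i, i < k -> lookup l i = f i.
Proof.
elim: k f => [|k IHk] f; first by exists 0.
have [l lE] := IHk (f \o succn); exists (cpair (f 0) l) => -[|i] lt_ik.
  by rewrite /lookup unpairE.
by rewrite /lookup iterSr unpairE; apply: lE.
Qed.

Lemma lookup_tuple (G : Type) (V : nat -> G) n (v : 'I_n -> G) :
  (forall x, exists i, V i = x) -> exists l, forall i : 'I_n, V (lookup l i) = v i.
Proof.
move=> surjV; have [nm nmE] := choice (fun i => surjV (v i)).
have [l lE] := lookup_ex (fun i => if insub i is Some j then nm j else 0) n.
by exists l => i; rewrite lE // valK.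
Qed.

Lemma computable_lookup X f g : computable X f -> computable X g ->
  computable X (fun z => lookup (f z) (g z)).
Proof.
move=> fc gc; apply/computable_cfst/(@computable_iter _ (fun _ => csnd)) => //.
by rewrite /computable2; comp.
Qed.
Hint Resolve computable_lookup : comp.

Definition add p c := if `[< consistent (fand p c) >] then fand p c else p.

Definition decide p s :=
  fand p (if `[< consistent (fand p (cpair 0 s)) >] then cpair 0 s else fnot (cpair 0 s)).

(* [s = cpair (cpair k l) c] asks for a solution of the formula [c], the first
   [k] variables of which are parameters listed in [l]; the others are replaced
   by generators exceeding all the names occurring in [p] and [l]. *)
Definition henkin p s :=
  sub_qf (fun i => if i < cfst (cfst s) then lookup (csnd (cfst s)) i
                   else cpair 4 (cpair (p + s) i)) (csnd s).

(** Each existential task is visited once, at the stage that codes it. If [add] drops it as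
    inconsistent with the condition, no extension of the limit group can solve it. *)
Definition step p s x :=
  add (decide (add p x) s) (henkin (decide (add p x) s) s).

Lemma add_entails p c : entails (add p c) p.
Proof. by rewrite /add; case: ifP => _ delta //; rewrite /fand evE => /andP[]. Qed.

Lemma add_consistent p c : consistent p -> consistent (add p c).
Proof. by rewrite /add; case: asboolP. Qed.

Lemma add_in p c : consistent (fand p c) -> entails (add p c) c.
Proof. by rewrite /add => /asboolP-> delta; rewrite /fand evE => /andP[]. Qed.

Lemma decide_entails p s : entails (decide p s) p.
Proof. by move=> delta; rewrite /decide /fand evE => /andP[]. Qed.

Lemma decide_consistent p s : consistent p -> consistent (decide p s).
Proof.
move=> cp; rewrite /decide; case: asboolP => // n.
by have [] := consistent_split (cpair 0 s) cp.
Qed.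

Section ComputableStep.

Variable X : set nat.
Hypothesis leX : turing_le zero_jump X.
Local Notation comp := (computable X).

Lemma computable_consistent_in f : comp f -> comp (fun z => `[< consistent (f z) >]).
Proof.
by move=> fc; apply: (computable_comp (computable_turing_le leX computable_consistent)).
Qed.

Lemma computable_fand f g : comp f -> comp g -> comp (fun z => fand (f z) (g z)).
Proof. by move=> *; rewrite /fand; comp. Qed.

Lemma computable_fnot f : comp f -> comp (fun z => fnot (f z)).
Proof. by move=> *; rewrite /fnot; comp. Qed.

Hint Resolve computable_consistent_in computable_fand computable_fnot : comp.

Lemma computable_add_cond f g : comp f -> comp g -> comp (fun z => add (f z) (g z)).
Proof. by move=> *; rewrite /add; comp. Qed.

Lemma computable_step f g h : comp f -> comp g -> comp h ->
  comp (fun z => step (f z) (g z) (h z)).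
Proof.
move=> fc gc hc; have hk : computable2 X henkin.
  apply: (@computable_sub_qf _ (fun z i => if i < cfst (cfst (csnd z))
    then lookup (csnd (cfst (csnd z))) i else cpair 4 (cpair (cfst z + csnd z) i))).
    by rewrite /computable2; comp.
  by comp.
have dc : comp (fun z => decide (add (f z) (h z)) (g z)).
  have := computable_add_cond fc hc => ?.
  by rewrite /decide; comp.
by apply: computable_add_cond => //; apply: (computable_comp2 hk dc gc).
Qed.

End ComputableStep.

Section Construction.

Variables (ex : nat -> nat -> nat) (p0 : nat).
Hypothesis p0_consistent : consistent p0.

(** [ex] is the strategy of the particular construction: trivial for [M], and [omit] for [N]. *)
Definition cond t := nat_rect (fun=> nat) p0 (fun t p => step p t (ex p t)) t.

Let pre t := add (cond t) (ex (cond t) t).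
(** The limit diagram, read off from the decision taken at stage [k]; it is therefore computable
    from any oracle that runs the construction and decides consistency. *)
Let delta k := `[< consistent (fand (pre k) (cpair 0 k)) >].

Lemma cond_consistent t : consistent (cond t).
Proof.
by elim: t => //= t IHt; apply/add_consistent/decide_consistent/add_consistent.
Qed.

Lemma condS_entails t :
  entails (cond t.+1) (decide (pre t) t) /\ entails (cond t.+1) (pre t).
Proof.
split; first exact: add_entails.
by move=> d /add_entails/decide_entails.
Qed.

Lemma cond_entails t t' : t <= t' -> entails (cond t') (cond t).
Proof.
move/subnK <-; elim: (t' - t) => [//|m IHm] d /(condS_entails _).2/add_entails.
exact: IHm.
Qed.

Lemma cond_decides t d : ev d (cond t) -> forall k, k < t -> d k = delta k.
Proof.
move=> dt k lt_kt; have := (condS_entails k).1 _ (cond_entails lt_kt dt).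
rewrite /decide /fand evE -/(delta k) => /andP[_].
by case: (delta k); rewrite /fnot !evE // => /negbTE.
Qed.

Lemma delta_cond t : ev delta (cond t).
Proof.
(* By this stage every atom that can occur in [cond t] has been decided, so an assignment satisfying
   the later condition agrees there with [delta]. *)
have /satisfiableP[d] := cond_consistent (t + (cond t).+1) 0.
rewrite /fand evE => /andP[dt _].
rewrite -(@ev_agree d); first by apply: cond_entails dt; rewrite leq_addr.
by move=> k le_k; apply: cond_decides dt _ _; rewrite ltn_addl.
Qed.

Lemma delta_diagram : group_diagram delta.
Proof.
apply/group_axiomP => i.
have /satisfiableP[d] := cond_consistent (group_axiom i).+1 i.+1.
rewrite /fand evE => /andP[dt /ev_group_axioms/(_ i (ltnSn i))].
by rewrite (@ev_agree d delta) // => k le_k; apply: cond_decides dt _ _.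
Qed.

Lemma computable_cond X : turing_le zero_jump X -> computable2 X ex -> computable X cond.
Proof.
move=> leX exc.
apply: (@computable_rec _ _ (fun _ t p => step p t (ex p t))); try by comp.
by apply: computable_step => //; try apply: (computable_comp2 exc); comp.
Qed.

Lemma multiplicative_interp (M N : groupType) (f : {multiplicative M -> N})
    (V : nat -> M) :
  interp V -> interp (f \o V).
Proof.
move=> [V1 VM VV Vvar].
have f1 : f 1%g = 1%g by apply: (@mulgI _ (f 1%g)); rewrite -gmulfM !mulg1.
split=> [|a b|a|a] /=; first by rewrite V1.
- by rewrite VM gmulfM.
- by rewrite VV; apply: (@mulgI _ (f (V a))); rewrite -gmulfM !mulgV.
- by rewrite Vvar.
Qed.

(** A solution in an extension serves to reinterpret the fresh generators, so that the current
    condition and the requested formula hold together. The formula is thus consistent with the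
    condition and was added. *)
Lemma generic_existentially_closed (G : groupType) (V : nat -> G) :
  interp V -> (forall x, exists i, V i = x) -> diag V =1 delta ->
  existentially_closed G.
Proof.
move=> iV surjV VE k phi m N f injf [w satw].
have [l lE] := lookup_tuple m surjV.
pose h (a : 'I_k + 'I_(ex_arity phi)) : nat :=
  match a with inl i => i | inr j => k + j end.
pose c := qf_code (qf_map h (ex_matrix phi)).
pose s := cpair (cpair k l) c; pose p := decide (pre s) s; pose b := p + s.
pose v i := if i < k then lookup l i else cpair 4 (cpair b i).
have henkinE : henkin p s = sub_qf v c by rewrite /henkin !unpairE.
have vl (i : 'I_k) : v i = lookup l i by rewrite /v ltn_ord.
have vr (j : 'I_(ex_arity phi)) : v (k + j) = cpair 4 (cpair b (k + j)).
  by rewrite /v ltnNge leq_addr.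
pose V0 := f \o V; have iV0 : interp V0 by apply: multiplicative_interp.
(* The generators reserved for this task receive the solution [w]. They exceed [b], so the names
   occurring in [p] and [l] keep their values. *)
pose g n := if (cfst n == 4) && (cfst (csnd n) == b) then
  (if insub (csnd (csnd n) - k) is Some j then w j else 1%g) else V0 n.
have gE n : n <= b -> g n = V0 n.
  rewrite /g; case: ifP => // /andP[/eqP n4 /eqP nb].
  rewrite leqNgt -(unpairK n) n4 (leq_ltn_trans _ (@ltn_cpairr 4 _ _)) //.
  by rewrite -{1}nb leq_cfst.
pose V' := group_val g; have iV' : interp V' by apply: interp_group_val.
have V'E := group_val_agree iV0 gE.
have lleb i : lookup l i <= b.
  apply: leq_trans (lookup_leq _ _) _; apply: leq_trans (leq_addl p s).
  exact: leq_trans (leq_cpairr k l) (leq_cpairl _ _).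
have satc : ev (diag V') (sub_qf v c).
  apply/(ev_sub_qf iV')/qf_sat_map.
  rewrite (_ : (V' \o v) \o h =
    fun a => match a with inl i => (f \o m) i | inr j => w j end) //.
  apply/funext => -[i|j] /=; first by rewrite vl /V' V'E // /V0 /= lE.
  rewrite vr /V' /group_val name_val_gen // /g !unpairE !eqxx addKn.
  by rewrite valK.
have satp : ev (diag V') p.
  rewrite (@eq_diag_le _ V' V0); last first.
    by move=> n le_np; apply: V'E; rewrite (leq_trans le_np) ?leq_addr.
  (* As [f] is injective, [V0] satisfies the same equations as [V]. *)
  rewrite (@ev_agree _ delta) => [|j _]; last first.
    by rewrite -VE; apply/asboolP/asboolP => [/injf//|E]; rewrite /V0 /= E.
  exact: (condS_entails s).1 (delta_cond _).
have cons : consistent (fand p (henkin p s)).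
  apply: (consistent_diagram (interp_diagram iV')).
  by rewrite /fand evE satp henkinE.
have : ev (diag V) (sub_qf v c).
  rewrite (@ev_agree _ delta) // -henkinE.
  exact: (add_in cons) (delta_cond s.+1).
move/(ev_sub_qf iV)/qf_sat_map => sat; exists (fun j => V (v (k + j))).
rewrite (_ : (fun a => _) = (V \o v) \o h) //.
by apply/funext => -[i|j] //=; rewrite vl lE.
Qed.

Lemma generic_group : exists (G : groupType) (V : nat -> G),
  [/\ interp V, forall x, exists i, V i = x, existentially_closed G,
      forall t, ev (diag V) (cond t) &
      forall X, turing_le zero_jump X -> computable2 X ex ->
        computable X (fun k => diag V k)].
Proof.
have [G [V [iV surjV VE]]] := diagram_group delta_diagram; exists G, V; split=> //.
- exact: generic_existentially_closed VE.
- by move=> t; rewrite (@ev_agree _ delta) ?delta_cond.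
move=> X leX exc.
apply: (@eq_computable _ (fun k => delta k)) => [k|]; first by rewrite VE.
apply: computable_consistent_in => //; apply: computable_fand; last by comp.
have cc := computable_cond leX exc; apply: computable_add_cond => //.
by apply: (computable_comp2 exc); comp.
Qed.

End Construction.

Lemma consistent_true : consistent ftrue.
Proof. by apply: (@consistent_diagram xpredT); [split | rewrite /ftrue evE]. Qed.

(** * Isolation *)

Lemma type_sat (G : groupType) n (v : 'I_n -> G) Phi phi :
  complete_qf_type Phi -> satisfies_type v Phi -> Phi phi <-> qf_sat v phi.
Proof.
move=> [_ cPhi] vPhi; split=> [/vPhi//|sat].
by have [//|/vPhi] := cPhi phi.
Qed.

Section DecodeNames.

Variables (n b : nat).

(** Turns names back into terms: generators become quantified variables. [inord] is faithful up to
    [b], and names up to [b] involve no larger generator. *)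
Definition name_term : nat -> term ('I_n + 'I_b.+1) :=
  name_val TOne (@TMul _) (@TInv _) (fun k => TVar (inr (inord k))).

Definition name_qf : nat -> qf_formula ('I_n + 'I_b.+1) :=
  trec (fun k x y z =>
    if cfst k == 0 then QEq (name_term (cfst (csnd k))) (name_term (csnd (csnd k)))
    else if cfst k == 1 then QNot x else if cfst k == 2 then QAnd y z
    else if cfst k == 3 then QOr y z else QEq TOne TOne) (QEq TOne TOne).

Definition name_formula (l p : nat) : ex_formula n :=
  @ExFormula n b.+1 (foldr (@QAnd _) (name_qf p)
    (map (fun i : 'I_n => QEq (TVar (inl i)) (name_term (lookup l i))) (enum 'I_n))).

Variables (G : groupType) (v : 'I_n + 'I_b.+1 -> G).

Let U := group_val (fun k => v (inr (inord k))).

Lemma eval_name_term k : eval_term v (name_term k) = U k.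
Proof.
apply: trec_morph => // m x y z.
by case: (cfst m) => [|[|[|[|a]]]] //=; case: ifP.
Qed.

Lemma sat_name_qf p : qf_sat v (name_qf p) <-> ev (diag U) p.
Proof.
suff <- : `[< qf_sat v (name_qf p) >] = ev (diag U) p by split=> /asboolP.
apply: (trec_morph (phi := fun phi => `[< qf_sat v phi >])) => [|m x y z].
  by apply/asboolP.
have [_|_] := eqVneq (cfst m) 0; first by rewrite /= !eval_name_term.
case: (cfst m) => [|[|[|[|a]]]] /=;
  by rewrite ?asbool_neg ?asbool_and ?asbool_or //; apply/asboolP.
Qed.

Lemma sat_name_formula l p : qf_sat v (ex_matrix (name_formula l p)) <->
  ev (diag U) p /\ forall i : 'I_n, v (inl i) = U (lookup l i).
Proof.
rewrite /name_formula /= -sat_name_qf.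
have E : (forall i : 'I_n, v (inl i) = U (lookup l i)) <->
         {in enum 'I_n, forall i, v (inl i) = U (lookup l i)}.
  by split=> [H i _|H i]; apply: H; rewrite ?mem_enum.
rewrite E; elim: (enum _) => [|i s IHs] /=; first by split=> [//|[]].
rewrite IHs eval_name_term; split=> [[Ei [Ep Es]]|[Ep Es]].
  by split=> // j; rewrite inE => /predU1P[->//|/Es].
split; first by apply: Es; rewrite mem_head.
by split=> // j js; apply: Es; rewrite inE js orbT.
Qed.

End DecodeNames.

(* If the condition [p] does not force any new formula on the tuple named by
   [l], then "some elements satisfy [p], the tuple being named by [l]" isolates
   the type. *)
Lemma consistent_isolated n (Phi : set (qf_formula 'I_n)) p l :
  complete_qf_type Phi -> consistent p ->
  (forall (G : groupType) (V : nat -> G), interp V -> ev (diag V) p ->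
    satisfies_type (fun i => V (lookup l i)) Phi) ->
  ex_isolated Phi.
Proof.
move=> cPhi cp forced; pose b := p + l.
exists (name_formula n b l p); split=> [|Psi cPsi [G [v [vPsi [w]]]]]; last first.
  move=> /sat_name_formula[]; set U := group_val _ => pU /= vU.
  have vPhi : satisfies_type v Phi.
    have := forced _ _ (interp_group_val _) pU.
    by congr satisfies_type; apply/funext => i; rewrite vU.
  apply/funext => phi; apply/propext.
  by rewrite (type_sat _ cPhi vPhi) (type_sat _ cPsi vPsi).
(* The construction started at [p] with trivial requests supplies a group satisfying [p]. *)
have [G [V [iV _ _ pV _]]] := generic_group (fun _ _ => ftrue) cp.
have {}pV : ev (diag V) p := pV 0.
exists G, (fun i => V (lookup l i)); split; first exact: forced.
exists (fun j => V j); apply/sat_name_formula.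
have UE k : k <= b -> group_val (fun k => V (@inord b k)) k = V k.
  by apply: group_val_agree => // m le_mb; rewrite inordK.
split=> [|i] /=; last by rewrite UE // (leq_trans (lookup_leq _ _)) ?leq_addl.
rewrite (@eq_diag_le _ _ V) // => k le_kp.
by rewrite UE // (leq_trans le_kp) ?leq_addr.
Qed.

(** * Omitting the types realised in a given group *)

Section Omitting.

(* [m] is the diagram of the group whose types are to be omitted, and [g] bounds
   the searches.  A requirement [e = cpair n (cpair l l')] asks the [n]-tuple
   named by [l] not to have the type of the [n]-tuple of the given group named
   by [l']. *)
Variables (m : nat -> bool) (g : nat -> nat).

(** Formulas false of the given tuple are enough to tell types apart, because complete types contain
    each formula or its negation. *)
Definition differing e c :=
  is_qf (fun i => i < cfst e) c && ~~ ev m (sub_qf (lookup (csnd (csnd e))) c).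

Definition target e c := sub_qf (lookup (cfst (csnd e))) c.

Definition valid p e c := differing e c && `[< consistent (fand p (target e c)) >].

(** Inconsistency with the negation means that [p] already forces a distinguishing formula on the
    new tuple. *)
Definition settled p t e :=
  has (fun c => differing e c && ~~ `[< consistent (fand p (fnot (target e c))) >])
      (iota 0 (g t)).

Definition attention p t e := has (valid p e) (iota 0 (g t)) && ~~ settled p t e.

(** If nothing requires attention, the outer [find] returns [t.+1] and the request is arbitrary;
    this is harmless, since [add] only accepts consistent formulas. *)
Definition omit p t :=
  let e := find (attention p t) (iota 0 t.+1) in
  target e (find (valid p e) (iota 0 (g t))).

Section ComputableOmit.

Variable X : set nat.
Hypothesis leX : turing_le zero_jump X.
Hypothesis mc : computable X (fun k => m k).
Local Notation comp := (computable X).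

Lemma computable_target e c : comp e -> comp c -> comp (fun z => target (e z) (c z)).
Proof.
move=> ec cc; apply: (@computable_sub_qf _ (fun z => lookup (cfst (csnd (e z))))) => //.
have := computable_comp ec (computable_fst X) => ?.
by rewrite /computable2; comp.
Qed.

Lemma computable_differing e c : comp e -> comp c ->
  comp (fun z => differing (e z) (c z)).
Proof.
move=> ec cc; have := computable_comp ec (computable_fst X) => efc.
apply: computable_andb.
  apply: (@computable_is_qf _ (fun z i => i < cfst (e z))) => //.
  by rewrite /computable2; comp.
apply/computable_negb/(@computable_ev _ (fun _ => m)).
  by apply: (computable_comp mc); comp.
apply: (@computable_sub_qf _ (fun z => lookup (csnd (csnd (e z))))) => //.
by rewrite /computable2; comp.
Qed.

Lemma computable_valid p e c : comp p -> comp e -> comp c ->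
  comp (fun z => valid (p z) (e z) (c z)).
Proof.
move=> pc ec cc; apply: computable_andb; first exact: computable_differing.
apply: computable_consistent_in => //; apply: computable_fand => //.
exact: computable_target.
Qed.

Lemma computable_omit : comp g -> computable2 X omit.
Proof.
move=> gc; have validc : computable3 X (fun p e c => valid p e c).
  by apply: computable_valid; comp.
have settledc : computable3 X (fun p t e => settled p t e).
  apply: (@computable_has _ (fun z c => differing (csnd (csnd z)) c &&
    ~~ `[< consistent (fand (cfst z) (fnot (target (csnd (csnd z)) c))) >])).
    apply: computable_andb; first by apply: computable_differing; comp.
    apply/computable_negb/computable_consistent_in/computable_fand => //; first by comp.
    by apply/computable_fnot/computable_target; comp.
  by apply: (computable_comp gc); comp.
have attc : computable3 X (fun p t e => attention p t e).
  apply: computable_andb; last exact: computable_negb.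
  apply: (@computable_has _ (fun z c => valid (cfst z) (csnd (csnd z)) c)).
    by apply: (computable_comp3 validc); comp.
  by apply: (computable_comp gc); comp.
have findc : computable2 X (fun p t => find (attention p t) (iota 0 t.+1)).
  apply: (@computable_find _ (fun z e => attention (cfst z) (csnd z) e)); last by comp.
  by apply: (computable_comp3 attc); comp.
apply: computable_target => //.
apply: (@computable_find _ (fun z c =>
  valid (cfst z) (find (attention (cfst z) (csnd z)) (iota 0 (csnd z).+1)) c)).
  by apply: (computable_comp3 validc); try apply: (computable_comp2 findc); comp.
by apply: (computable_comp gc); comp.
Qed.

End ComputableOmit.

Hypothesis g_mono : {homo g : s t / s <= t}.

Local Notation cond := (cond omit ftrue).

Lemma find_iota (P : nat -> bool) k : has P (iota 0 k) ->
  find P (iota 0 k) < k /\ P (find P (iota 0 k)).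
Proof.
move=> hasP; have lt_k : find P (iota 0 k) < k by rewrite -{2}(size_iota 0 k) -has_find.
by split=> //; have := nth_find 0 hasP; rewrite nth_iota.
Qed.

Lemma attention_acts t e : e <= t -> attention (cond t) t e ->
  (forall e', e' < e -> ~~ attention (cond t) t e') ->
  exists c, [/\ c < g t, differing e c & entails (cond t.+1) (target e c)].
Proof.
move=> le_et att least; have findE : find (attention (cond t) t) (iota 0 t.+1) = e.
  have hasA : has (attention (cond t) t) (iota 0 t.+1).
    by apply/hasP; exists e; rewrite ?mem_iota.
  have [lt_t attf] := find_iota hasA; apply/eqP; rewrite eqn_leq; apply/andP; split.
    rewrite leqNgt; apply/negP => lt_e; have := before_find 0 lt_e.
    by rewrite nth_iota ?ltnS // add0n att.
  by rewrite leqNgt; apply/negP => /least; rewrite attf.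
have /andP[/find_iota[lt_g vc] _] := att.
exists (find (valid (cond t) e) (iota 0 (g t))); have /andP[dc /asboolP cc] := vc.
have omitE : omit (cond t) t = target e (find (valid (cond t) e) (iota 0 (g t))) :=
  congr1 (fun e => target e (find (valid (cond t) e) (iota 0 (g t)))) findE.
split; [exact: lt_g | exact: dc |] => d dS; apply: (add_in cc); rewrite -omitE.
exact: (condS_entails omit ftrue t).2 dS.
Qed.

(** A finite injury argument. Once the smaller requirements are quiet, [e] acts at most once more:
    the formula it forces is entailed by all later conditions, and as [g] is monotone it stays
    within the range where [settled] looks. *)
Lemma attention_finite e : exists s, forall t, s <= t -> forall e', e' < e ->
  ~~ attention (cond t) t e'.
Proof.
elim: e => [|e [s IHs]]; first by exists 0.
have [[t [le_t att]]|never] :=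
  pselect (exists t, maxn s e <= t /\ attention (cond t) t e).
  move: le_t; rewrite geq_max => /andP[le_st le_et].
  have [c [lt_c dc cc]] := attention_acts le_et att (IHs t le_st).
  exists t.+1 => t' lt_tt' e'; rewrite ltnS leq_eqVlt => /predU1P[->|]; last first.
    by apply/IHs/(leq_trans le_st)/ltnW.
  rewrite negb_and negbK; apply/orP; right; apply/hasP; exists c.
    by rewrite mem_iota add0n (leq_trans lt_c) // g_mono // ltnW.
  rewrite dc /=; apply/asboolP => /(_ 0) /satisfiableP[d].
  rewrite /fand /fnot !evE => /andP[/andP[dt]] /negP[].
  exact/cc/(cond_entails lt_tt').
exists (maxn s e) => t le_t e'; rewrite ltnS leq_eqVlt => /predU1P[->|]; last first.
  by apply: IHs; apply: leq_trans le_t; rewrite leq_maxl.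
by apply/negP => att; apply: never; exists t.
Qed.

(** At the actual condition of a late stage the least valid formula is not below [g]. Taking the
    maximum of these least formulas over all numbers up to a bound for that condition yields a bound
    for [g] without knowing the condition. *)
Lemma computable_bound e s :
  computable zero_jump (fun k => m k) ->
  (forall p, consistent p -> exists c, valid p e c) ->
  (forall t c, s <= t -> valid (cond t) e c -> g t <= c) ->
  exists2 f, computable zero_jump f & forall t, s <= t -> g t <= f t.
Proof.
move=> mc exv gv; have le0 : turing_le zero_jump zero_jump.
  by exists Oracle => n; split=> H; constructor.
(* The guard makes the search total: inconsistent numbers get the value 0. *)
pose P p c := `[< consistent p >] ==> valid p e c.
have exP p : exists c, P p c.
  rewrite /P; case: asboolP => cp; last by exists 0.
  exact: exv.
pose h p := ex_minn (exP p).
have hP p : P p (h p) by rewrite /h; case: ex_minnP.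
have hc : computable zero_jump h.
  apply: (@computable_mu _ P) => // [|p c lt_c]; last first.
    apply/negP => Pc; move: lt_c; rewrite /h.
    by case: ex_minnP => k _ /(_ _ Pc); rewrite ltnNge => ->.
  rewrite /P; apply: (@eq_computable _ (fun z => `[< consistent (cfst z) >] &&
    ~~ valid (cfst z) e (csnd z))).
    by move=> z; rewrite negb_imply.
  apply: computable_andb; first by apply: computable_consistent_in => //; comp.
  by apply/computable_negb/computable_valid => //; comp.
pose F q := \max_(p < q.+1) h p.
have Fc : computable zero_jump F.
  apply: (@computable_bigmax _ (fun _ p => h p)); last by comp.
  by apply: (computable_comp hc); comp.
(* Bounds every possible next condition. The ranges include [t.+1] and [F q], because the two [find]
   in [omit] may return their defaults [t.+1] and [g t]. *)
pose N t q := \max_(p < q.+1) \max_(e' < t.+2) \max_(c < (F q).+1) step p t (target e' c).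
have leN t q p e' c : p <= q -> e' <= t.+1 -> c <= F q -> step p t (target e' c) <= N t q.
  move=> le_p le_e le_c; rewrite /N.
  apply: leq_trans (leq_bigmax (Ordinal (le_p : p < q.+1))).
  apply: leq_trans (leq_bigmax (Ordinal (le_e : e' < t.+2))).
  by apply: leq_trans (leq_bigmax (Ordinal (le_c : c < (F q).+1))).
have Nc : computable2 zero_jump N.
  apply: (@computable_bigmax _
     (fun z p => \max_(e' < (cfst z).+2) \max_(c < (F (csnd z)).+1)
     step p (cfst z) (target e' c))); last by comp.
  apply: (@computable_bigmax _ (fun z e' => \max_(c < (F (csnd (cfst z))).+1)
     step (csnd z) (cfst (cfst z)) (target e' c))); last by comp.
  apply: (@computable_bigmax _ (fun z c =>
     step (csnd (cfst z)) (cfst (cfst (cfst z))) (target (csnd z) c))).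
    by apply: computable_step => //; try apply: computable_target; comp.
  by apply/computable_succ/(computable_comp Fc); comp.
(* The condition [cond s] enters as a single constant; from there on [g] is not consulted, so [Q] is
   computable from 0'. *)
pose Q j := nat_rect (fun=> nat) (cond s) (fun j q => N (s + j) q) j.
have gF j : cond (s + j) <= Q j -> g (s + j) <= F (Q j).
  move=> le_Q; have := hP (cond (s + j)).
  rewrite /P asboolT /=; last exact: cond_consistent consistent_true _.
  move/gv => /(_ (leq_addr _ _)) /leq_trans; apply.
  exact: (leq_bigmax (Ordinal (le_Q : cond (s + j) < (Q j).+1))).
have condQ j : cond (s + j) <= Q j.
  elim: j => [|j IHj]; first by rewrite addn0.
  rewrite addnS /=; apply: leN => //.
    by rewrite -[X in _ <= X](size_iota 0); apply: find_size.
  apply: leq_trans (gF _ IHj).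
  by rewrite -[X in _ <= X](size_iota 0); apply: find_size.
exists (fun t => F (Q (t - s))); last first.
  by move=> t /subnKC E; rewrite -{1}E; apply: gF.
apply: computable_comp => //.
apply: (@computable_rec _ _ (fun _ j q => N (s + j) q)); try by comp.
by apply: (computable_comp2 Nc); comp.
Qed.

End Omitting.

Lemma omitting_relatively_atomic (M N : groupType) (V : nat -> M) (W : nat -> N) g :
  interp V -> (forall x, exists i, V i = x) -> computable zero_jump (fun k => diag V k) ->
  interp W -> (forall x, exists i, W i = x) ->
  (forall t, ev (diag W) (cond (omit (diag V) g) ftrue t)) ->
  {homo g : s t / s <= t} ->
  (forall f s, computable zero_jump f -> exists2 t, s <= t & f t < g t) ->
  relatively_atomic M N.
Proof.
move=> iV surjV Vc iW surjW Wcond g_mono escape n Phi cPhi [v vPhi] [w wPhi].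
apply: contrapT => niso.
have [l' l'E] := lookup_tuple v surjV; have [l lE] := lookup_tuple w surjW.
pose e := cpair n (cpair l l').
have nP i : (i < n) <-> exists x : 'I_n, val x = i.
  by split=> [lt_in|[x <-]]; [exists (Ordinal lt_in) | apply: ltn_ord].
have subE (G : groupType) (U : nat -> G) k (u : 'I_n -> G) phi : interp U ->
    (forall i : 'I_n, U (lookup k i) = u i) -> satisfies_type u Phi ->
    ev (diag U) (sub_qf (lookup k) (qf_code (qf_map val phi))) <-> Phi phi.
  move=> iU kE uPhi; rewrite (ev_sub_qf iU) qf_sat_map (type_sat _ cPhi uPhi).
  by rewrite (_ : (U \o _) \o _ = u) //; apply/funext.
have differ c : differing (diag V) e c -> ~~ ev (diag W) (target e c).
  rewrite /differing /target !unpairE => /andP[/(is_qfP nP)[phi <-]].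
  move=> /negP nV; apply/negP => /(subE _ _ _ _ _ iW lE wPhi) Pphi.
  exact/nV/(subE _ _ _ _ _ iV l'E vPhi).
(* If no formula were valid at [p], then [p] would force all of [Phi] on the tuple named by [l], and
   [Phi] would be isolated. *)
have exv p : consistent p -> exists c, valid (diag V) p e c.
  move=> cp; apply: contrapT => nv; apply: niso.
  apply: (@consistent_isolated _ _ p l) => // G U iU pU phi Pphi.
  apply: contrapT => nphi; apply: nv.
  exists (qf_code (qf_map val (QNot phi))).
  rewrite /valid /differing /target !unpairE; rewrite -andbA; apply/and3P; split.
  - by apply/(is_qfP nP); exists (QNot phi).
  - apply/negP => /(subE _ _ _ _ _ iV l'E vPhi) nP'.
    by have := vPhi _ Pphi; exact: (vPhi _ nP').
  - apply/asboolP/(consistent_diagram (interp_diagram iU)).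
    rewrite /fand ev_and pU andTb; apply/(ev_sub_qf iU)/qf_sat_map => /=.
    by move=> sat; apply: nphi.
have [s0 quiet] := attention_finite (diag V) g_mono e.
suff gv t c : maxn s0 e <= t -> valid (diag V) (cond (omit (diag V) g) ftrue t) e c ->
    g t <= c.
  have [f fc gf] := computable_bound Vc exv gv.
  by have [t le_t] := escape f (maxn s0 e) fc; rewrite ltnNge gf.
(* A valid formula within the bound would make [e] act: smaller requirements are quiet, and [e] is
   never settled because [N] satisfies the conditions and both tuples have the same type. Acting
   would then separate the tuples. *)
rewrite geq_max => /andP[le_s0 le_e] vc; rewrite leqNgt; apply/negP => lt_c.
have att : attention (diag V) g (cond (omit (diag V) g) ftrue t) t e.
  apply/andP; split; first by apply/hasP; exists c; rewrite ?mem_iota.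
  apply/hasPn => c' _; rewrite negb_and negbK.
  case: (boolP (differing _ _ _)) => //= /differ nW.
  apply/asboolP/(consistent_diagram (interp_diagram iW)).
  by rewrite /fand /fnot !evE Wcond.
have [c' [_ /differ/negP nW cc']] := attention_acts le_e att (quiet t le_s0).
exact/nW/cc'/Wcond.
Qed.

Theorem corollary7p0p3 (A : set nat)
  (A_ce : ce_in zero_jump A)
  (A_above : turing_le zero_jump A)
  (A_strict : ~ turing_le A zero_jump) :
  exists M N : groupType,
    [/\ existentially_closed M, existentially_closed N,
        computable_group A M, computable_group A N
      & relatively_atomic M N].
Proof.
have [g [gc g_mono escape]] := ce_escape A_ce A_above A_strict.
have le0 : turing_le zero_jump zero_jump.
  by exists Oracle => n; split=> H; constructor.
have [M [V [iV surjV ecM _ Vc]]] := generic_group (fun _ _ => ftrue) consistent_true.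
(* Two oracles are needed: [A] for presenting the groups, and 0' for the domination argument. *)
have {}Vc X : turing_le zero_jump X -> computable X (fun k => diag V k).
  by move=> leX; apply: Vc => //; apply: computable_const.
have [N [W [iW surjW ecN Wcond Wc]]] := generic_group (omit (diag V) g) consistent_true.
exists M, N; split=> //.
- exact: computable_group_diag (Vc _ A_above).
- apply: (computable_group_diag iW surjW); apply: Wc => //.
  by apply: computable_omit => //; apply: Vc.
- exact: (omitting_relatively_atomic (g := g) iV surjV (Vc _ le0) iW surjW Wcond).
Qed.
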